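(* Let $(E_n)_{n\in\mathbb N}$ be any betting sequence on the filtered space described in the context, with wealth process $(W_t)_{t\in\mathbb N_0}$, and let $s\in(0,\infty)$, $\beta=\frac1{1+s}$. Then: (a) for every $t\in\mathbb N$, $$\mathbb E_{\mathbb P_1}\Big[W_t^{-s}\exp\Big(\sum_{n\le t}\lambda_n(\beta)\Big)\Big]\ \ge\ 1;$$ (b) if $\bar\lambda_n(\beta)\in[0,\infty]$ are constants with $\lambda_n(\beta)\le\bar\lambda_n(\beta)$ $\mathbb P_1$-a.s., then $\Lambda^{(t)}_s\le\frac1t\sum_{n\le t}\bar\lambda_n(\beta)$ for every $t\in\mathbb N$; (c) in the i.i.d. model, $\Lambda^{(t)}_s\le\lambda(\beta)$ for every $t\in\mathbb N$, with equality for a given $t$ if and only if $E_n=R_\beta(X_n)$ $\mathbb P_1$-a.s. for every $n\le t$ (equivalently $\mathbb P_0$-a.s., when $P_0$ and $P_1$ are mutually absolutely continuous).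
   Context: Setting: $(\Omega,\mathcal F)$ is a measurable space with a filtration $(\mathcal F_t)_{t\in\mathbb N_0}$, $\mathcal F_0=\{\emptyset,\Omega\}$, and $\mathbb P_0,\mathbb P_1$ are probability measures on it. Standing assumption: for every $t\in\mathbb N=\{1,2,\dots\}$, $\mathbb P_1\ll\mathbb P_0$ on $\mathcal F_t$ and $\mathrm{KL}(\mathbb P_1|_{\mathcal F_t}\|\mathbb P_0|_{\mathcal F_t})<\infty$. $L_t:=\frac{d\mathbb P_1|_{\mathcal F_t}}{d\mathbb P_0|_{\mathcal F_t}}$, $L_0=1$; $R_t:=L_t/L_{t-1}$ on $\{L_{t-1}>0\}$, $R_t:=1$ elsewhere. For $\beta\in(0,1]$: $Z_{\beta,t}:=\mathbb E_{\mathbb P_0}[R_t^\beta\mid\mathcal F_{t-1}]$, $\lambda_t(\beta):=-\frac1\beta\log Z_{\beta,t}$. A betting sequence is a sequence $(E_t)_{t\in\mathbb N}$ of $\mathcal F_t$-measurable $E_t:\Omega\to[0,\infty]$ with $\mathbb E_{\mathbb P_0}[E_t\mid\mathcal F_{t-1}]\le1$ $\mathbb P_0$-a.s.; its wealth process is $W_0=1$, $W_t=\prod_{n\le t}E_n$; and $\Lambda^{(t)}_s:=-\frac1t\log\mathbb E_{\mathbb P_1}[W_t^{-s}]$. The i.i.d. model generated by probability measures $P_0,P_1$ on $(\mathcal X,\mathcal B_{\mathcal X})$ is the instance $\Omega=\mathcal X^{\mathbb N}$ with coordinates $X_n$, $\mathcal F_t=\sigma(X_1,\dots,X_t)$, $\mathbb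 P_i=P_i^{\otimes\mathbb N}$; the standing assumption then says $P_1\ll P_0$ and $\mathrm{KL}(P_1\|P_0)<\infty$. There $R:=\frac{dP_1}{dP_0}$, $Z_\beta:=\mathbb E_{P_0}[R^\beta]$, $\lambda(\beta):=-\frac1\beta\log Z_\beta$, $R_\beta:=R^\beta/Z_\beta$. Conventions: for $s>0$, $0^{-s}=+\infty$, $(+\infty)^{-s}=0$; $0\cdot\infty=0$; $\log(+\infty)=+\infty$. *)

(* Defs.v *)
From HB Require Import structures.
From mathcomp Require Import all_boot all_order all_algebra.
From mathcomp Require Import all_classical all_reals all_analysis.
From mathcomp Require Import measurable_realfun.

Set Implicit Arguments.
Unset Strict Implicit.
Unset Printing Implicit Defensive.
Import Order.TTheory GRing.Theory Num.Theory.
Import numFieldNormedType.Exports.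

Local Open Scope classical_set_scope.
Local Open Scope ring_scope.
Local Open Scope ereal_scope.

Record sub_sigma d (T : measurableType d) := SubSigma {
  sub_sigma_sets :> set (set T);
  sub_sigma_algebra : sigma_algebra setT sub_sigma_sets;
  sub_sigma_measurable : sub_sigma_sets `<=` measurable }.

Lemma sub_sigma_generated d (T : measurableType d) (G : sub_sigma T) :
  <<s G >> `<=` measurable.
Proof.
rewrite (sigma_algebra_id (sub_sigma_algebra G)).
exact: sub_sigma_measurable.
Qed.

(* [g_sigma_algebraType G] is T equipped with <<s G >>, which equals G since G
   is a sigma-algebra. *)
Definition measurable_wrt d (T : measurableType d) (R : realType)
    (G : sub_sigma T) (f : T -> \bar R) : Prop :=
  measurable_fun setT (f : g_sigma_algebraType G -> \bar R).

(* P|_G, as a probability measure on (T, G) *)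
Definition restr d (T : measurableType d) (R : realType) (G : sub_sigma T)
  (P : probability T R) : set (g_sigma_algebraType G) -> \bar R := P.
Arguments restr {d T R} G P _.

Section restr_probability.
Context d (T : measurableType d) (R : realType).
Variables (G : sub_sigma T) (P : probability T R).

Let restr0 : restr G P set0 = 0.
Proof. exact: measure0. Qed.

Let restr_ge0 A : 0 <= restr G P A.
Proof. exact: measure_ge0. Qed.

Let restr_sigma_additive : semi_sigma_additive (restr G P).
Proof.
move=> F mF tF mUF; apply: measure_semi_sigma_additive => //.
  by move=> i; exact: (sub_sigma_generated (mF i)).
exact: (sub_sigma_generated mUF).
Qed.

HB.instance Definition _ := isMeasure.Build _ _ _ (restr G P)
  restr0 restr_ge0 restr_sigma_additive.

Let restr_setT : restr G P setT = 1.
Proof. exact: probability_setT. Qed.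

HB.instance Definition _ := Measure_isProbability.Build _ _ _ (restr G P)
  restr_setT.

End restr_probability.

Record filtration d (T : measurableType d) := Filtration {
  filt :> nat -> sub_sigma T;
  filt_nondecreasing : forall m n, (m <= n)%N -> filt m `<=` filt n;
  filt_trivial : filt 0%N = [set set0; setT] :> set (set T) }.

Local Open Scope charge_scope.

Definition KL d (T : measurableType d) (R : realType) (nu mu : probability T R)
  : \bar R :=
  if `[< nu `<< mu >] then
    \int[nu]_x lne (('d (charge_of_finite_measure nu) '/d mu) x)
  else +oo.

(* f is a [0, oo)-valued version of d nu / d mu *)
Definition is_density d (T : measurableType d) (R : realType)
    (nu mu : probability T R) (f : T -> R) : Prop :=
  [/\ measurable_fun setT f,
      forall x, (0 <= f x)%R
    & {ae mu, forall x, (f x)%:E = ('d (charge_of_finite_measure nu) '/d mu) x}].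

(* Y is a [0, oo]-valued version of E_P[X | G], for measurable X >= 0 *)
Definition is_cond_exp d (T : measurableType d) (R : realType)
    (P : probability T R) (G : sub_sigma T) (X Y : T -> \bar R) : Prop :=
  [/\ measurable_wrt G Y,
      forall x, 0 <= Y x
    & forall A, sub_sigma_sets G A -> \int[P]_(x in A) Y x = \int[P]_(x in A) X x].

Definition standing_assumption d (T : measurableType d) (R : realType)
    (F : filtration T) (P0 P1 : probability T R) : Prop :=
  forall t, (0 < t)%N ->
    restr (F t) P1 `<< restr (F t) P0 /\
    KL (restr (F t) P1) (restr (F t) P0) < +oo.

(* L is any choice of versions of the likelihood ratios L_t *)
Definition is_likelihood_ratio d (T : measurableType d) (R : realType)
    (F : filtration T) (P0 P1 : probability T R) (L : nat -> T -> R) : Prop :=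
  L 0%N = cst 1%R /\
  forall t, (0 < t)%N -> is_density (restr (F t) P1) (restr (F t) P0) (L t).

(* R_t, for t >= 1 *)
Definition lr_increment (T : Type) (R : realType) (L : nat -> T -> R)
    (t : nat) (w : T) : R :=
  if (0 < L t.-1 w)%R then (L t w / L t.-1 w)%R else 1%R.

(* Z t is any version of Z_{beta,t} = E_{P0}[R_t ^ beta | F_{t-1}] *)
Definition is_Z d (T : measurableType d) (R : realType)
    (F : filtration T) (P0 : probability T R) (L : nat -> T -> R) (beta : R)
    (Z : nat -> T -> \bar R) : Prop :=
  forall t, (0 < t)%N ->
    is_cond_exp P0 (F t.-1) (fun w => (lr_increment L t w `^ beta)%:E) (Z t).

(* lambda as a function of the value z of Z_{beta,t} (or of Z_beta) *)
Definition lambda_of (R : realType) (beta : R) (z : \bar R) : \bar R :=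
  - ((beta^-1)%:E * lne z).

(* Only the terms E t with t >= 1 are meaningful. *)
Definition is_betting_sequence d (T : measurableType d) (R : realType)
    (F : filtration T) (P0 : probability T R) (E : nat -> T -> \bar R) : Prop :=
  forall t, (0 < t)%N ->
    [/\ measurable_wrt (F t) (E t),
        forall w, 0 <= E t w
      & exists2 Y, is_cond_exp P0 (F t.-1) (E t) Y
                 & {ae P0, forall w, Y w <= 1}].

Definition wealth (T : Type) (R : realType) (E : nat -> T -> \bar R)
    (t : nat) (w : T) : \bar R :=
  \prod_(1 <= n < t.+1) E n w.

(* x ^ (- s) for x in [0, oo] and s > 0: [inve] has 0^-1 = +oo and +oo^-1 = 0,
   whereas [poweR 0 (- s)] is 0. *)
Definition neg_poweR (R : realType) (x : \bar R) (s : R) : \bar R :=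
  (x `^ s)^-1.

Definition Lambda d (T : measurableType d) (R : realType)
    (P1 : probability T R) (E : nat -> T -> \bar R) (s : R) (t : nat) : \bar R :=
  - ((t%:R^-1)%:E * lne (\int[P1]_w neg_poweR (wealth E t w) s)).

(* The i.i.d. model. A point w : nat -> X lists the observations from index 0,
   so that X_n w = w n.-1 for n >= 1. *)

Definition coordinate (X : Type) (n : nat) (w : nat -> X) : X := w n.-1.

Definition coordinate_sets d (X : measurableType d) : set (set (nat -> X)) :=
  \bigcup_(n : nat)
    preimage_set_system setT (fun w : nat -> X => w n) measurable.
Arguments coordinate_sets {d} X _.

Definition seqspace d (X : measurableType d) : measurableType _ :=
  g_sigma_algebraType (coordinate_sets X).

Section iid_filtration.
Context d (X : measurableType d).

(* sigma(X_1, ..., X_t) *)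
Definition sigma_coordinates (t : nat) : set (set (seqspace X)) :=
  g_sigma_preimage (fun (i : 'I_t) (w : nat -> X) => w i).

Lemma sigma_coordinates_algebra t : sigma_algebra setT (sigma_coordinates t).
Proof. exact: smallest_sigma_algebra. Qed.

Lemma sigma_coordinates_measurable t : sigma_coordinates t `<=` measurable.
Proof.
apply: sub_sigma_algebra2; apply: (big_ind (fun A => A `<=` _)) => //.
  by move=> A B sA sB; rewrite subUset.
by move=> i _ A iA; exists (val i).
Qed.

Lemma sigma_coordinates_nondecreasing m n : (m <= n)%N ->
  sigma_coordinates m `<=` sigma_coordinates n.
Proof.
move=> mn; apply: sub_sigma_algebra2; apply: (big_ind (fun A => A `<=` _)) => //.
  by move=> A B sA sB; rewrite subUset.
by move=> i _; rewrite (bigD1 (widen_ord mn i))//=.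
Qed.

Lemma sigma_coordinates0 : sigma_coordinates 0 = [set set0; setT].
Proof.
apply/seteqP; split=> [|A [->|->]].
- rewrite /sigma_coordinates /g_sigma_preimage big_ord0.
  apply: smallest_sub => //; split=> [|A [->|->]|A mA]; first by left.
  + by right; rewrite setD0.
  + by left; rewrite setDv.
  + have [[k Ak]|nA] := pselect (exists k, A k = setT).
      by right; apply/seteqP; split=> // x _; exists k => //; rewrite Ak.
    left; rewrite bigcup0// => k _.
    by have [//|Ak] := mA k; case: nA; exists k.
- exact: sigma_algebra0.
- have [_ + _] := sigma_coordinates_algebra 0.
  move=> /(_ set0); rewrite setD0; apply; exact: sigma_algebra0.
Qed.

Definition iid_filtration : filtration (seqspace X) :=
  @Filtration _ (seqspace X)
    (fun t => SubSigma (@sigma_coordinates_algebra t)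
                       (@sigma_coordinates_measurable t))
    sigma_coordinates_nondecreasing sigma_coordinates0.

End iid_filtration.

(* PP is the countable power of P: these values on the cylinders, a
   pi-system generating the sigma-algebra of [seqspace X], determine it. *)
Definition is_countable_power d (X : measurableType d) (R : realType)
    (P : probability X R) (PP : probability (seqspace X) R) : Prop :=
  forall (n : nat) (A : nat -> set X), (forall i, measurable (A i)) ->
    PP [set w | forall i, (i < n)%N -> A i (w i)] = \prod_(i < n) P (A i).

Definition iid_Z d (X : measurableType d) (R : realType)
    (P0 : probability X R) (r : X -> R) (beta : R) : \bar R :=
  \int[P0]_x (r x `^ beta)%:E.

(* R_beta = R ^ beta / Z_beta *)
Definition tilted_ratio d (X : measurableType d) (R : realType)
    (P0 : probability X R) (r : X -> R) (beta : R) (x : X) : \bar R :=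
  (r x `^ beta)%:E / iid_Z P0 r beta.

(* Main.v *)
(* Write D_t for the product over n <= t of R_n^beta / Z_n. It is the wealth of a
   betting sequence with conditional means exactly 1, so E_{P0}[D_t] = 1, while
   E_{P0}[W_t] <= 1 for every wealth W. Young's inequality
     (1 + s) D <= s W + D^(1 + s) W^(-s),
   with equality only if W = D, then gives E_{P0}[D_t^(1+s) W_t^(-s)] >= 1.
   Since beta (1 + s) = 1, D_t^(1+s) <= L_t exp(lambda_1 + ... + lambda_t), and a
   change of measure turns this into (a), hence (b). In the i.i.d. model this is
   an equality and the lambda_n are constant, so equality in (c) means
   E_{P0}[D_t^(1+s) W_t^(-s)] = 1, that is W_t = D_t P0-a.s. Comparing the
   supermartingale W with the martingale D backwards in time gives W_n = D_n for
   n <= t, and E_n = R_beta(X_n) follows by division, as D_n > 0 P1-a.s. *)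

From HB Require Import structures.
Require Import Defs.
From mathcomp Require Import all_boot all_order all_algebra.
From mathcomp Require Import all_classical all_reals all_analysis.
From mathcomp Require Import measurable_realfun ring lra.
Set Implicit Arguments.
Unset Strict Implicit.
Unset Printing Implicit Defensive.
Import Order.TTheory GRing.Theory Num.Theory.
Import numFieldNormedType.Exports.
Local Open Scope classical_set_scope.
Local Open Scope ring_scope.
Local Open Scope ereal_scope.

Import HBNNSimple.

(** * Functions measurable for a sub-sigma-algebra *)

(** Absolute continuity is available only on each [F t]: on the whole sequence space the powers of
    two distinct laws are mutually singular. An almost sure statement therefore passes between the
    two measures only when its exceptional event lies in some [F t], which is why membership in
    [F t] is tracked throughout. A wealth may take the values 0 and +oo, and its negative power may
    have infinite integral. Hence all expectations are integrals of [0, +oo]-valued functions,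
    subtraction occurs only against finite quantities, and conditional expectations are used through
    their integrals over sets of the sub-sigma-algebra. That D is a legitimate wealth rests on 0 <
    Z_n < +oo holding P0-a.s.; both bounds come from moving between L_n and L_(n+1) through P1. The
    power of D is in general only bounded by L times the exponential factor, because of the
    convention R = 1 after L has vanished. The equality case cannot afford this loss, so the i.i.d.
    part works with the product of the one-step densities, for which the identity is exact at every
    point. *)

Lemma sub_sigma_measurableE d (T : measurableType d) (G : sub_sigma T) :
  @measurable _ (g_sigma_algebraType G) = G.
Proof. exact/sigma_algebra_id/Defs.sub_sigma_algebra. Qed.

Lemma mem_sub_sigma d (T : measurableType d) (G : sub_sigma T) (A : set T) :
  measurable (A : set (g_sigma_algebraType G)) -> sub_sigma_sets G A.
Proof. by rewrite sub_sigma_measurableE. Qed.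

Lemma measurable_sub_sigmaW d d' (T : measurableType d) (U : measurableType d')
    (G : sub_sigma T) (f : T -> U) :
  measurable_fun setT (f : g_sigma_algebraType G -> U) -> measurable_fun setT f.
Proof.
move=> mf _ B mB; apply: (@sub_sigma_generated _ _ G); exact: mf.
Qed.

Lemma measurable_sub_sigmaS d d' (T : measurableType d) (U : measurableType d')
    (G H : sub_sigma T) (f : T -> U) : G `<=` H ->
  measurable_fun setT (f : g_sigma_algebraType G -> U) ->
  measurable_fun setT (f : g_sigma_algebraType H -> U).
Proof.
move=> GH mf _ B mB; rewrite sub_sigma_measurableE; apply: GH.
by rewrite -sub_sigma_measurableE; exact: mf.
Qed.

(** The level sets of a [G]-simple function lie in [G], so its product with [X] integrates to a
    combination of integrals of [X] over sets of [G], the only integrals on which a conditional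
    expectation or a density is prescribed. *)
Lemma integral_nnsfunM d (T : measurableType d) (R : realType)
    (P : {measure set T -> \bar R}) (G : sub_sigma T)
    (h : {nnsfun g_sigma_algebraType G >-> R}) (X : T -> \bar R) :
  measurable_fun setT X -> (forall x, 0 <= X x) ->
  \int[P]_x ((h x)%:E * X x) =
  \sum_(y \in range h) y%:E * \int[P]_(x in h @^-1` [set y]) X x.
Proof.
move=> mX X0.
have mh y : measurable (h @^-1` [set y] : set T).
  apply: (@sub_sigma_generated _ _ G).
  rewrite -[h @^-1` _]setTI; exact: (@measurable_funPT _ _ _ _ h).
have mI y : measurable_fun setT (\1_(h @^-1` [set y]) : T -> R).
  exact: measurable_indic.
transitivity (\int[P]_x (\sum_(y \in range h)
    ((y * \1_(h @^-1` [set y]) x)%:E * X x))).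
  apply: eq_integral => x _; rewrite -ge0_mule_fsuml; last first.
    by move=> y; exact: nnfun_muleindic_ge0.
  by rewrite fsumEFin// -(fimfunE h x).
rewrite ge0_integral_fsum//; first last.
- by move=> y x _; rewrite mule_ge0// nnfun_muleindic_ge0.
- move=> y; apply: emeasurable_funM => //; apply/measurable_EFinP.
  exact: measurable_funM.
apply: eq_fsbigr => y /[!inE] -[t _ <-].
under eq_integral do rewrite EFinM -muleA.
rewrite ge0_integralZl_EFin//; first last.
- by apply: emeasurable_funM => //; exact/measurable_EFinP.
- by move=> x _; rewrite mule_ge0.
congr (_ * _); rewrite [RHS]integral_mkcond.
by apply: eq_integral => x _; rewrite epatch_indic muleC.
Qed.

(** Since [c] may be +oo, continuity of the product fails at 0 * oo. If [f x] is 0, however, all the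
    approximants vanish at [x], so the sequence is constantly 0. *)
Lemma cvg_nnsfun_approxM d (T : measurableType d) (R : realType)
    (f : T -> \bar R) (mf : measurable_fun setT f) (c : \bar R) x :
  (forall x, 0 <= f x) ->
  (nnsfun_approx measurableT mf n x)%:E * c @[n --> \oo] --> f x * c.
Proof.
move=> f0.
have cvgf : (nnsfun_approx measurableT mf n x)%:E @[n --> \oo] --> f x.
  by apply: cvg_nnsfun_approx => // y _.
have [->|c0] := eqVneq c 0.
  by rewrite mule0; under eq_fun do rewrite mule0; exact: cvg_cst.
have [fx0|fx0] := eqVneq (f x) 0.
  rewrite fx0 mul0e [X in X @ _](_ : _ = cst 0); first exact: cvg_cst.
  apply/funext => n /=; rewrite [X in X * _](_ : _ = 0) ?mul0e//.
  apply/eqP; rewrite eq_le -[X in _ <= X]fx0 nnsfun_approxE le_approx//=.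
  by rewrite lee_fin -nnsfun_approxE.
apply: cvgeM; [|exact: cvgf|exact: cvg_cst].
by rewrite mule_defE (negbTE c0) (negbTE fx0).
Qed.

(* With [P = Q] this pulls a [G]-measurable factor out of a conditional
   expectation; with [Y = 1] it is the change of measure by a density [X] of [Q]
   with respect to [P] on [G]. *)
Lemma ge0_integralM_eq d (T : measurableType d) (R : realType)
    (P Q : {measure set T -> \bar R}) (G : sub_sigma T) (X Y H : T -> \bar R) :
  measurable_fun setT X -> (forall x, 0 <= X x) ->
  measurable_fun setT Y -> (forall x, 0 <= Y x) ->
  (forall A, sub_sigma_sets G A -> \int[P]_(x in A) X x = \int[Q]_(x in A) Y x) ->
  measurable_wrt G H -> (forall x, 0 <= H x) ->
  \int[P]_x (H x * X x) = \int[Q]_x (H x * Y x).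
Proof.
move=> mX X0 mY Y0 XY mH H0.
pose h := nnsfun_approx measurableT mH.
have intM (M : {measure set T -> \bar R}) (Z : T -> \bar R) :
    measurable_fun setT Z -> (forall x, 0 <= Z x) ->
    \int[M]_x (H x * Z x) = limn (fun n => \int[M]_x ((h n x)%:E * Z x)).
  move=> mZ Z0; rewrite -monotone_convergence//.
  - apply: eq_integral => x _; apply/esym/cvg_lim => //.
    exact: cvg_nnsfun_approxM.
  - move=> n; apply: emeasurable_funM => //; apply/measurable_EFinP.
    exact: (@measurable_sub_sigmaW _ _ _ _ G).
  - by move=> n x _; rewrite mule_ge0// lee_fin.
  - move=> x _ m n mn; rewrite lee_wpmul2r// lee_fin.
    by have /lefP := nd_nnsfun_approx measurableT mH mn; exact.
rewrite !intM//; congr (limn _); apply/funext => n.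
rewrite !integral_nnsfunM//; apply: eq_fsbigr => y _.
rewrite XY//; apply: mem_sub_sigma; rewrite -[_ @^-1` _]setTI.
exact: (@measurable_funPT _ _ _ _ (h n)).
Qed.

(** * Young's inequality in expectation *)

(** A strict inequality on some [A] would have to be compensated on its complement, where the
    inequality goes the same way. Finiteness of the total allows the part over the complement to be
    cancelled. *)
Lemma ge0_ae_eq_set_le d (T : measurableType d) (R : realType)
    (mu : {measure set T -> \bar R}) (f g : T -> \bar R) :
  measurable_fun setT f -> measurable_fun setT g ->
  (forall x, 0 <= f x) -> (forall x, 0 <= g x) ->
  (forall A, measurable A -> \int[mu]_(x in A) f x <= \int[mu]_(x in A) g x) ->
  \int[mu]_x g x <= \int[mu]_x f x -> \int[mu]_x f x < +oo ->
  ae_eq mu setT f g.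
Proof.
move=> mf mg f0 g0 fg gf foo.
have split_int h A : measurable A -> measurable_fun setT h ->
    (forall x, 0 <= h x) ->
    \int[mu]_x h x = \int[mu]_(x in A) h x + \int[mu]_(x in ~` A) h x.
  move=> mA mh h0; rewrite -(setUv A) ge0_integral_setU//.
  - exact: measurableC.
  - exact: measurable_funTS.
  - by rewrite disj_set2E setICr.
apply: integral_ae_eq => //.
  apply/integrableP; split => //.
  by under eq_integral do rewrite gee0_abs//.
move=> A _ mA; apply/eqP; rewrite eq_le fg//=.
have mAC : measurable (~` A) by exact: measurableC.
have gAoo : \int[mu]_(x in ~` A) g x \is a fin_num.
  rewrite ge0_fin_numE ?integral_ge0//; apply: le_lt_trans foo.
  by apply: le_trans gf; exact: ge0_subset_integral.
rewrite -(leeD2rE _ _ gAoo) -split_int//; apply: (le_trans gf).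
by rewrite (split_int f _ mA)// leeD2l// fg.
Qed.

(* [g] need not be measurable: the integral of a nonnegative function is a
   supremum over simple functions below it. *)
Lemma ae_le_integral_lower d (T : measurableType d) (R : realType)
    (mu : {measure set T -> \bar R}) (f g : T -> \bar R) :
  measurable_fun setT f -> (forall x, 0 <= f x) -> (forall x, 0 <= g x) ->
  {ae mu, forall x, f x <= g x} -> \int[mu]_x f x <= \int[mu]_x g x.
Proof.
move=> mf f0 g0 [N [mN N0 fgN]].
rewrite (ge0_negligible_integral mN _ _ _ N0)// setTD integral_mkcond.
rewrite ge0_integralTE; last by move=> x; exact: erestrict_ge0.
rewrite [leRHS]ge0_integralTE//.
apply: le_ereal_sup => _ [h /= hf <-]; exists h => //= x.
apply: (le_trans (hf x)); rewrite /patch; case: ifPn => // /[!inE] xN.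
by apply: contrapT => /fgN.
Qed.

(** The values 0 and +oo of the power are split off; in between, the inverse is a real power of
    exponent -1, hence measurable. *)
Lemma measurable_neg_poweR d (T : measurableType d) (R : realType)
    (f : T -> \bar R) (s : R) :
  (forall x, 0 <= f x) -> measurable_fun setT f ->
  measurable_fun setT (fun x => neg_poweR (f x) s).
Proof.
move=> f0 mf.
have mg : measurable_fun setT (fun x => f x `^ s).
  exact: measurableT_comp (measurable_poweR _) mf.
rewrite (_ : (fun x => _) = fun x => if f x `^ s == 0 then +oo else
    if f x `^ s == +oo then 0 else ((fine (f x `^ s))^-1)%:E); last first.
  apply/funext => x; rewrite /neg_poweR.
  case: (f x `^ s) (poweR_ge0 (f x) s) => [r _||]; last by rewrite leeNy_eq.
    by rewrite inver eqe.
  by rewrite invey.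
apply: measurable_fun_ifT => //; first exact: measurable_fun_eqe.
apply: measurable_fun_ifT => //; first exact: measurable_fun_eqe.
apply/measurable_EFinP.
rewrite (_ : (fun x => _) = fun x => (fine (f x `^ s)) `^ (-1))%R; last first.
  by apply/funext => x; rewrite powR_inv1// fine_ge0// poweR_ge0.
apply: measurableT_comp (measurable_powR _) _.
exact: measurableT_comp (fine_measurable _) mg.
Qed.

Lemma neg_poweR_ge0 (R : realType) (x : \bar R) (s : R) : 0 <= neg_poweR x s.
Proof. by rewrite inve_ge0 poweR_ge0. Qed.

Lemma neg_poweR0 (R : realType) (s : R) : (0 < s)%R -> neg_poweR 0 s = +oo.
Proof. by move=> s0; rewrite /neg_poweR poweR0r ?inve0// gt_eqF. Qed.

Lemma neg_poweRy (R : realType) (s : R) : (0 < s)%R -> neg_poweR +oo s = 0.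
Proof. by move=> s0; rewrite /neg_poweR poweRyr ?invey// gt_eqF. Qed.

Lemma neg_poweR_EFin (R : realType) (w s : R) :
  (0 < w)%R -> neg_poweR w%:E s = (w `^ (- s))%:E.
Proof. by move=> w0; rewrite /neg_poweR/= inver gt_eqF ?powR_gt0// powRN. Qed.

(* For [d != w] both terms on the right of
   [1 + s <= s * (w / d) + (d / w) ^ s] lie strictly above the tangents
   [s * (1 - l)] and [1 + s * l] in [l = ln (d / w)]. *)
Lemma young_lt (R : realType) (s w d : R) : (0 < s)%R -> (0 < w)%R -> (0 <= d)%R ->
  d != w -> ((1 + s) * d < s * w + d `^ (1 + s) * w `^ (- s))%R.
Proof.
move=> s0 w0; rewrite le_eqVlt => /predU1P[<- _|d0 dw].
  by rewrite mulr0 powR0 ?mul0r ?addr0 ?mulr_gt0// gt_eqF// addr_gt0.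
set l := (ln d - ln w)%R.
have l0 : l != 0%R.
  by rewrite subr_eq0; apply: contra_neq dw => /ln_inj; apply; rewrite posrE.
have wE : w = (d * expR (- l))%R.
  by rewrite opprB expRD expRN !lnK ?posrE// mulrCA mulfV ?mulr1// gt_eqF.
have -> : (d `^ (1 + s) * w `^ (- s) = d * expR (s * l))%R.
  rewrite powRD ?gt_eqF ?addr_gt0// powRr1 ?ltW// -mulrA; congr (_ * _)%R.
  by rewrite /powR !gt_eqF// -expRD; congr (expR _); rewrite /l; ring.
rewrite {1}wE; have h1 : (1 + - l < expR (- l))%R.
  by apply: expR_gt1Dx; rewrite oppr_eq0.
have h2 : (1 + s * l < expR (s * l))%R.
  by apply: expR_gt1Dx; rewrite mulf_neq0// gt_eqF.
rewrite [X in (_ < X)%R](_ : _ = d * (s * expR (- l) + expR (s * l)))%R; last by ring.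
rewrite mulrC ltr_pM2l//; nra.
Qed.

(** At the two new endpoints the right-hand side is +oo: for [W] = 0 through the negative power, as
    then [d] > 0, and for [W] = +oo through the linear term. *)
Lemma young_ereal (R : realType) (s d : R) (W : \bar R) :
  (0 < s)%R -> (0 <= d)%R -> 0 <= W -> d%:E != W ->
  ((1 + s) * d)%:E < s%:E * W + (d `^ (1 + s))%:E * neg_poweR W s.
Proof.
move=> s0 d0; case: W => [w||]//=; rewrite ?lee_fin.
- rewrite le_eqVlt eqe => /predU1P[<- dw|w0 dw].
    rewrite neg_poweR0// mule0 add0e gt0_muley ?ltry// lte_fin powR_gt0//.
    by rewrite lt_neqAle eq_sym dw.
  by rewrite neg_poweR_EFin// -!EFinM -EFinD lte_fin young_lt.
- by move=> _ _; rewrite neg_poweRy// mule0 adde0 gt0_muley ?ltry// lte_fin.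
Qed.

(** At [d] = 0 this relies on 0 * oo = 0: the negative power is +oo there and its coefficient
    vanishes. *)
Lemma young_ereal_eq (R : realType) (s d : R) : (0 < s)%R -> (0 <= d)%R ->
  s%:E * d%:E + (d `^ (1 + s))%:E * neg_poweR d%:E s = ((1 + s) * d)%:E.
Proof.
move=> s0; rewrite le_eqVlt => /predU1P[<-|d0].
  by rewrite mule0 add0e powR0 ?mul0e ?mulr0// gt_eqF// addr_gt0.
rewrite neg_poweR_EFin// -!EFinM -EFinD; congr EFin.
by rewrite -powRD ?(gt_eqF d0) ?implybT// addrK powRr1 ?ltW//; ring.
Qed.

Section young_expectation.
Context d (T : measurableType d) (R : realType) (P : {measure set T -> \bar R}).
Variables (s : R) (W : T -> \bar R) (D : T -> R).
Hypotheses (s_gt0 : (0 < s)%R)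
  (mW : measurable_fun setT W) (W_ge0 : forall x, 0 <= W x)
  (mD : measurable_fun setT D) (D_ge0 : forall x, (0 <= D x)%R)
  (intW : \int[P]_x W x <= 1) (intD : \int[P]_x (D x)%:E = 1).

Let N x := (D x `^ (1 + s))%:E * neg_poweR (W x) s.

Let N_ge0 x : 0 <= N x.
Proof. by rewrite mule_ge0 ?lee_fin ?powR_ge0 ?neg_poweR_ge0. Qed.

Let mN : measurable_fun setT N.
Proof.
apply: emeasurable_funM; last exact: measurable_neg_poweR.
by apply/measurable_EFinP; exact: measurableT_comp (measurable_powR _) mD.
Qed.

Let intf : \int[P]_x ((1 + s) * D x)%:E = (1 + s)%:E.
Proof.
under eq_integral do rewrite EFinM.
by rewrite ge0_integralZl_EFin ?intD ?mule1 ?addr_ge0 ?ltW//;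
  [move=> x _; rewrite lee_fin|exact/measurable_EFinP].
Qed.

Let intg : \int[P]_x (s%:E * W x + N x) = s%:E * \int[P]_x W x + \int[P]_x N x.
Proof.
rewrite ge0_integralD//.
- by rewrite ge0_integralZl_EFin// ltW.
- by move=> x _; rewrite mule_ge0// lee_fin ltW.
- exact: measurable_funeM.
Qed.

Let le_fg x : ((1 + s) * D x)%:E <= s%:E * W x + N x.
Proof.
rewrite /N; have [<-|DW] := eqVneq (D x)%:E (W x).
  by rewrite young_ereal_eq.
exact/ltW/young_ereal.
Qed.

Let mf : measurable_fun setT (fun x => ((1 + s) * D x)%:E).
Proof. by apply/measurable_EFinP; exact: measurable_funM. Qed.

Let mg : measurable_fun setT (fun x => s%:E * W x + N x).
Proof. by apply: emeasurable_funD => //; exact: measurable_funeM. Qed.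

Let f_ge0 x : 0 <= ((1 + s) * D x)%:E.
Proof. by rewrite lee_fin mulr_ge0// addr_ge0// ltW. Qed.

Let le_intg : \int[P]_x (s%:E * W x + N x) <= s%:E + \int[P]_x N x.
Proof.
by rewrite intg leeD2r// -[leRHS]mule1 lee_wpmul2l// lee_fin ltW.
Qed.

Lemma young_expectation_ge1 : 1 <= \int[P]_x N x.
Proof.
have : (1 + s)%:E <= s%:E + \int[P]_x N x.
  by rewrite -intf; apply: le_trans le_intg; exact: ge0_le_integral.
by rewrite EFinD addeC leeD2lE.
Qed.

(** Under this bound both sides of Young's inequality have the same finite integral, so they agree
    almost everywhere, and strictness away from [W] = [D] does the rest. *)
Lemma young_expectation_eq : \int[P]_x N x <= 1 ->
  ae_eq P setT W (EFin \o D).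
Proof.
move=> N1; suff : ae_eq P setT (fun x => ((1 + s) * D x)%:E)
    (fun x => s%:E * W x + N x).
  apply: filterS => x /(_ I) fg _ /=; apply/eqP/contraT.
  rewrite eq_sym => /(young_ereal s_gt0 (D_ge0 x) (W_ge0 x)).
  by rewrite fg /N ltxx.
apply: ge0_ae_eq_set_le => //.
- by move=> x; exact: le_trans (f_ge0 x) (le_fg x).
- by move=> A mA; apply: ge0_le_integral => //;
    [exact: measurable_funTS|exact: measurable_funTS].
- rewrite intf; apply: (le_trans le_intg).
  by rewrite EFinD [leRHS]addeC leeD2l.
- by rewrite intf ltry.
Qed.

End young_expectation.

(** * Wealth processes *)

(** [restr G P] is the image of [P] under the identity map from T to (T, [G]), so this is the change
    of variables formula. *)
Lemma integral_restr d (T : measurableType d) (R : realType) (G : sub_sigma T)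
    (P : probability T R) (f : T -> \bar R) (A : set T) :
  measurable_wrt G f -> (forall x, 0 <= f x) -> sub_sigma_sets G A ->
  \int[restr G P]_(x in A) f x = \int[P]_(x in A) f x.
Proof.
move=> mf f0 GA.
have mid : measurable_fun setT (id : T -> g_sigma_algebraType G).
  by move=> _ B mB; rewrite setTI; exact: (@sub_sigma_generated _ _ G).
have mA : measurable (A : set (g_sigma_algebraType G)).
  by rewrite sub_sigma_measurableE.
have := @ge0_integral_pushforward _ _ _ _ R _ mid P A f mA.
rewrite preimage_id => <- //; last exact: measurable_funTS.
Qed.

Lemma ae_restr d (T : measurableType d) (R : realType) (G : sub_sigma T)
    (P : probability T R) (Q : T -> Prop) :
  {ae restr G P, forall x, Q x} -> {ae P, forall x, Q x}.
Proof.
by move=> [N [mN N0 QN]]; exists N; split => //; exact: (@sub_sigma_generated _ _ G).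
Qed.

Lemma integral_probability1 d (T : measurableType d) (R : realType)
  (P : probability T R) : \int[P]_x (1 : \bar R) = 1.
Proof. by rewrite integral_cst// mul1e; exact: probability_setT. Qed.

Section wealth_process.
Context d (T : measurableType d) (R : realType).
Variables (F : filtration T) (P : probability T R).
Implicit Types E : nat -> T -> \bar R.

Definition is_fair_betting_sequence E : Prop := forall t, (0 < t)%N ->
  [/\ measurable_wrt (F t) (E t), forall w, 0 <= E t w
    & exists2 Y, is_cond_exp P (F t.-1) (E t) Y & {ae P, forall w, Y w = 1}].

Lemma fair_betting_sequence E :
  is_fair_betting_sequence E -> is_betting_sequence F P E.
Proof.
move=> fE t /fE[mE E0 [Y EY Y1]]; split => //; exists Y => //.
by apply: filterS Y1 => w ->.
Qed.

Lemma wealth0 E w : wealth E 0 w = 1.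
Proof. by rewrite /wealth big_nil. Qed.

Lemma wealthS E t w : wealth E t.+1 w = wealth E t w * E t.+1 w.
Proof. by rewrite /wealth big_nat_recr. Qed.

Lemma wealth_ge0 E t w : is_betting_sequence F P E -> 0 <= wealth E t w.
Proof.
move=> bE; elim: t => [|t IH]; first by rewrite wealth0.
by rewrite wealthS mule_ge0//; have [] := bE t.+1.
Qed.

Lemma measurable_wealth E t : is_betting_sequence F P E ->
  measurable_wrt (F t) (wealth E t).
Proof.
move=> bE; elim: t => [|t IH].
  rewrite (_ : wealth E 0 = cst 1); first exact: measurable_cst.
  by apply/funext => w; exact: wealth0.
rewrite /measurable_wrt (_ : wealth E t.+1 = wealth E t \* E t.+1)%E; last first.
  by apply/funext => w; exact: wealthS.
apply: emeasurable_funM; last by have [] := bE t.+1.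
by apply: (measurable_sub_sigmaS (G := F t)) => //; exact: filt_nondecreasing.
Qed.

(** The indicator of [A] is absorbed into the [G]-measurable factor, which reduces the claim to
    integrals over the whole space. *)
Lemma cond_exp_integralM (G : sub_sigma T) (X Y H : T -> \bar R) (A : set T) :
  measurable_fun setT X -> (forall x, 0 <= X x) -> is_cond_exp P G X Y ->
  measurable_wrt G H -> (forall x, 0 <= H x) -> sub_sigma_sets G A ->
  \int[P]_(x in A) (H x * X x) = \int[P]_(x in A) (H x * Y x).
Proof.
move=> mX X0 [mY Y0 XY] mH H0 GA.
have patchM Z : \int[P]_(x in A) (H x * Z x) = \int[P]_x ((H x * (\1_A x)%:E) * Z x).
  rewrite integral_mkcond; apply: eq_integral => x _.
  by rewrite epatch_indic muleAC.
rewrite !patchM; apply: (@ge0_integralM_eq _ _ _ _ _ G) => //.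
- exact: measurable_sub_sigmaW mY.
- by move=> B GB; rewrite XY.
- apply: emeasurable_funM => //; apply/measurable_EFinP; apply: measurable_indic.
  by rewrite sub_sigma_measurableE.
- by move=> x; rewrite mule_ge0// lee_fin.
Qed.

Lemma wealth_conditional E t (Y : T -> \bar R) (A : set T) :
  is_betting_sequence F P E -> is_cond_exp P (F t) (E t.+1) Y ->
  sub_sigma_sets (F t) A ->
  \int[P]_(x in A) wealth E t.+1 x = \int[P]_(x in A) (wealth E t x * Y x).
Proof.
move=> bE EY FA; under eq_integral do rewrite wealthS.
have [mE E0 _] := bE t.+1 isT.
apply: cond_exp_integralM FA => //.
- exact: measurable_sub_sigmaW mE.
- exact: measurable_wealth.
- by move=> x; exact: wealth_ge0.
Qed.

Lemma wealth_supermartingale E t (A : set T) :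
  is_betting_sequence F P E -> sub_sigma_sets (F t) A ->
  \int[P]_(x in A) wealth E t.+1 x <= \int[P]_(x in A) wealth E t x.
Proof.
move=> bE FA; have [mE E0 [Y EY Y1]] := bE t.+1 isT.
rewrite (wealth_conditional (Y := Y))//.
have [mY Y0 _] := EY.
have mA : measurable A := sub_sigma_measurable FA.
have mW := measurable_sub_sigmaW (measurable_wealth (t := t) bE).
apply: ae_ge0_le_integral => //.
- by move=> x _; rewrite mule_ge0// wealth_ge0.
- apply/measurable_funTS/emeasurable_funM => //.
  exact: measurable_sub_sigmaW mY.
- by move=> x _; exact: wealth_ge0.
- exact: measurable_funTS.
- apply: filterS Y1 => x Y1 _.
  by rewrite -[leRHS]mule1 lee_wpmul2l// wealth_ge0.
Qed.

Lemma wealth_martingale E t (A : set T) :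
  is_fair_betting_sequence E -> sub_sigma_sets (F t) A ->
  \int[P]_(x in A) wealth E t.+1 x = \int[P]_(x in A) wealth E t x.
Proof.
move=> fE FA; have bE := fair_betting_sequence fE.
have [mE E0 [Y EY Y1]] := fE t.+1 isT.
rewrite (wealth_conditional (Y := Y))//.
have [mY Y0 _] := EY.
have mA : measurable A := sub_sigma_measurable FA.
have mW := measurable_sub_sigmaW (measurable_wealth (t := t) bE).
apply: ge0_ae_eq_integral => //.
- apply/measurable_funTS/emeasurable_funM => //.
  exact: measurable_sub_sigmaW mY.
- exact: measurable_funTS.
- by move=> x _; rewrite mule_ge0// wealth_ge0.
- by move=> x _; exact: wealth_ge0.
- by apply: filterS Y1 => x Y1 _; rewrite Y1 mule1.
Qed.

Lemma sub_sigmaT (G : sub_sigma T) : sub_sigma_sets G setT.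
Proof. exact: mem_sub_sigma. Qed.

Lemma integral_wealth_le1 E t :
  is_betting_sequence F P E -> \int[P]_x wealth E t x <= 1.
Proof.
move=> bE; elim: t => [|t IH].
  under eq_integral do rewrite wealth0.
  by rewrite integral_probability1.
by apply: le_trans IH; apply: wealth_supermartingale => //; exact: sub_sigmaT.
Qed.

Lemma integral_fair_wealth E t :
  is_fair_betting_sequence E -> \int[P]_x wealth E t x = 1.
Proof.
move=> fE; elim: t => [|t <-]; last first.
  by apply: wealth_martingale => //; exact: sub_sigmaT.
under eq_integral do rewrite wealth0.
by rewrite integral_probability1.
Qed.

(** For A in [F t], the integral over A of the fair wealth at t equals that at t + 1, hence that of
    [wealth E t.+1], which is at most that of [wealth E t]. The totals compare the other way, being
    1 and at most 1. As only sets of [F t] are controlled, the comparison is made for the restricted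
    measure. *)
Lemma ae_eq_wealth_pred E E' t : is_betting_sequence F P E ->
  is_fair_betting_sequence E' ->
  ae_eq P setT (wealth E t.+1) (wealth E' t.+1) ->
  ae_eq P setT (wealth E t) (wealth E' t).
Proof.
move=> bE fE' EE'; have bE' := fair_betting_sequence fE'.
apply: (@ae_restr _ _ _ (F t)); apply: ae_eq_sym.
have mW E0 n : is_betting_sequence F P E0 -> measurable_fun setT (wealth E0 n).
  by move=> bE0; exact: measurable_sub_sigmaW (measurable_wealth (t := n) bE0).
have intR E0 A : is_betting_sequence F P E0 -> measurable A ->
    \int[restr (F t) P]_(x in A) wealth E0 t x = \int[P]_(x in A) wealth E0 t x.
  move=> bE0 mA; apply: integral_restr; first exact: measurable_wealth.
    by move=> x; exact: wealth_ge0.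
  exact: mem_sub_sigma.
apply: ge0_ae_eq_set_le.
- exact: measurable_wealth.
- exact: measurable_wealth.
- by move=> x; exact: wealth_ge0.
- by move=> x; exact: wealth_ge0.
- move=> A mA; rewrite !intR//; have FA := mem_sub_sigma mA.
  rewrite -wealth_martingale//; apply: le_trans (wealth_supermartingale bE FA).
  rewrite le_eqVlt; apply/orP; left; apply/eqP.
  have mA' : measurable (A : set T) := sub_sigma_measurable FA.
  apply: ge0_ae_eq_integral => //; try exact/measurable_funTS/mW.
  + by move=> x _; exact: wealth_ge0.
  + by move=> x _; exact: wealth_ge0.
  + by apply: filterS EE' => x WW' _; rewrite WW'.
- rewrite (intR E)// (intR E')// (integral_fair_wealth _ fE').
  exact: integral_wealth_le1 bE.
- by rewrite (intR E')// (integral_fair_wealth _ fE') ltry.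
Qed.

Lemma ae_eq_wealth_le E E' n t : is_betting_sequence F P E ->
  is_fair_betting_sequence E' -> (n <= t)%N ->
  ae_eq P setT (wealth E t) (wealth E' t) ->
  ae_eq P setT (wealth E n) (wealth E' n).
Proof.
move=> bE fE' /subnK <-; elim: (t - n)%N => [//|k IH].
by rewrite addSn => /ae_eq_wealth_pred => /(_ bE fE'); exact: IH.
Qed.

End wealth_process.

Local Open Scope charge_scope.

(** * The general filtered model *)

Lemma is_density_integral d (T : measurableType d) (R : realType)
    (nu mu : probability T R) (f : T -> R) (A : set T) :
  nu `<< mu -> is_density nu mu f -> measurable A ->
  nu A = \int[mu]_(x in A) (f x)%:E.
Proof.
move=> dom [mf f0 fae] mA.
transitivity (\int[mu]_(x in A) ('d (charge_of_finite_measure nu) '/d mu) x).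
  by rewrite -Radon_Nikodym_integral.
apply: ae_eq_integral => //.
- exact: measurable_funTS.
- by apply/measurable_funTS/measurable_EFinP.
- by apply: filterS fae => x + _; exact: esym.
Qed.

(** * Transfer between two measures related by a density on a sub-sigma-algebra *)

Section density_on_sub_sigma.
Context d (T : measurableType d) (R : realType).
Variables (G : sub_sigma T) (P0 P1 : probability T R) (L : T -> R).
Hypotheses (mL : measurable_fun setT (L : g_sigma_algebraType G -> R))
  (L_ge0 : forall x, (0 <= L x)%R)
  (P1E : forall A, sub_sigma_sets G A -> P1 A = \int[P0]_(x in A) (L x)%:E).

Let mLE : measurable_fun setT (fun x => (L x)%:E).
Proof. by apply/measurable_EFinP; exact: (measurable_sub_sigmaW (G := G)). Qed.

Lemma ge0_integral_density (H : T -> \bar R) :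
  measurable_wrt G H -> (forall x, 0 <= H x) ->
  \int[P0]_x (H x * (L x)%:E) = \int[P1]_x H x.
Proof.
move=> mH H0; under [RHS]eq_integral do rewrite -[H _]mule1.
apply: (@ge0_integralM_eq _ _ _ _ _ G) => // A GA.
by rewrite -P1E// integral_cst ?mul1e//; exact: sub_sigma_measurable GA.
Qed.

(** The exceptional set itself must belong to [G]: a null set covering it need not, and the density
    says nothing about its mass under [P1]. *)
Lemma ae_density (Q : T -> Prop) : sub_sigma_sets G [set x | ~ Q x] ->
  {ae P0, forall x, Q x} -> {ae P1, forall x, Q x}.
Proof.
move=> GQ [N [mN N0 QN]]; have mQ := sub_sigma_measurable GQ.
exists [set x | ~ Q x]; split => //.
rewrite (P1E GQ); apply: null_set_integral => //; first exact: measurable_funTS.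
by apply: subset_measure0 N0.
Qed.

Lemma ae_density_gt0 : {ae P1, forall x, (0 < L x)%R}.
Proof.
pose A := [set x | ~ (0 < L x)%R].
have GA : sub_sigma_sets G A.
  apply: mem_sub_sigma; rewrite [A](_ : _ = setT `&` [set x | (L x)%:E <= 0]).
    by apply: emeasurable_fun_infty_c => //; exact/measurable_EFinP.
  rewrite setTI; apply/seteqP; split => x /=; rewrite lee_fin leNgt.
    by move=> ?; apply/negP.
  by move/negP.
exists A; split => //; first exact: sub_sigma_measurable GA.
rewrite P1E//; apply: integral0_eq => x /negP; rewrite -leNgt => Lx.
by congr EFin; apply/eqP; rewrite eq_le Lx L_ge0.
Qed.

(** A [P1]-null set of [G] carries zero integral of [L] under [P0], so [L] vanishes almost
    everywhere on it; positivity of [L] leaves only a [P0]-null set. *)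
Lemma ae_density_conv (Q : T -> Prop) : {ae P0, forall x, (0 < L x)%R} ->
  sub_sigma_sets G [set x | ~ Q x] ->
  {ae P1, forall x, Q x} -> {ae P0, forall x, Q x}.
Proof.
move=> Lgt0 GQ [N [mN N0 QN]]; have mQ := sub_sigma_measurable GQ.
have P1Q : P1 [set x | ~ Q x] = 0 by apply: subset_measure0 N0.
have : ae_eq P0 [set x | ~ Q x] (fun x => (L x)%:E) (cst 0).
  apply/ae_eq_integral_abs => //; first exact: measurable_funTS.
  by under eq_integral do rewrite gee0_abs ?lee_fin//; rewrite -P1E.
apply: filterS2 Lgt0 => x Lx LQ; apply: contrapT => /LQ[] /eqP.
by rewrite gt_eqF.
Qed.

End density_on_sub_sigma.

(** This dominates the power of a likelihood ratio by an integrable function, and so makes the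
    normalizing constants finite. *)
Lemma powR_le1D (R : realType) (x b : R) :
  (0 <= x)%R -> (0 <= b <= 1)%R -> (x `^ b <= 1 + x)%R.
Proof.
move=> x0 /andP[b0 b1]; have [x1|x1] := leP 1%R x.
  rewrite (@le_trans _ _ (x `^ 1)%R) ?ler_powR//.
  by rewrite powRr1// lerDr.
rewrite (@le_trans _ _ (1 `^ b)%R)//.
  by rewrite ge0_ler_powR// ?nnegrE// ltW.
by rewrite powR1 lerDl.
Qed.

(** Taking logarithms needs a positive finite integral: the hypothesis excludes 0, and the value +oo
    makes [Lambda] equal to -oo. *)
Lemma le_Lambda d (T : measurableType d) (R : realType) (P : probability T R)
    (E : nat -> T -> \bar R) (s a : R) (t : nat) : (0 < t)%N ->
  1 <= (expR (t%:R * a))%:E * \int[P]_w neg_poweR (wealth E t w) s ->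
  Lambda P E s t <= a%:E.
Proof.
move=> t0; rewrite /Lambda.
have : 0 <= \int[P]_w neg_poweR (wealth E t w) s.
  by apply: integral_ge0 => w _; exact: neg_poweR_ge0.
have tV0 : (0 < t%:R^-1 :> R)%R by rewrite invr_gt0 ltr0n.
case: (\int[P]_w _) => [i||]//; last first.
  by move=> _ _; rewrite /= gt0_muley ?lte_fin//= leNye.
rewrite lee_fin => i0; rewrite -EFinM lee_fin => ei.
have {}i0 : (0 < i)%R.
  rewrite lt_neqAle i0 andbT; apply/eqP => i0'; move: ei.
  by rewrite -i0' mulr0 ler10.
rewrite lne_EFin// -EFinM -EFinN lee_fin.
move: ei; rewrite -[X in (_ * X)%R](lnK i0) -expRD -ler_ln ?posrE ?expR_gt0//.
rewrite ln1 expRK => ei.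
by rewrite lerNl -ler_pdivrMl ?invrK// mulrN; lra.
Qed.

Lemma expeR_lambda_of (R : realType) (s z : R) : (0 < s)%R -> (0 < z)%R ->
  expeR (lambda_of (1 + s)^-1 z%:E) = (z `^ (- (1 + s)))%:E.
Proof.
move=> s0 z0; rewrite /lambda_of lne_EFin// invrK/= /powR gt_eqF//.
by rewrite mulNr.
Qed.

Section general_model.
Context d (T : measurableType d) (R : realType).
Variables (F : filtration T) (P0 P1 : probability T R).
Hypothesis standing : standing_assumption F P0 P1.
Variable L : nat -> T -> R.
Hypothesis LR : is_likelihood_ratio F P0 P1 L.

Local Notation Rt := (lr_increment L).

Lemma likelihood_ratio_ge0 t x : (0 <= L t x)%R.
Proof.
case: LR => L0 Lt; case: t => [|t]; first by rewrite L0.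
by have [] := Lt t.+1 isT.
Qed.
Local Notation L_ge0 := likelihood_ratio_ge0.

Lemma measurable_likelihood_ratio t :
  measurable_fun setT (L t : g_sigma_algebraType (F t) -> R).
Proof.
case: LR => L0 Lt; case: t => [|t]; first by rewrite L0; exact: measurable_cst.
by have [] := Lt t.+1 isT.
Qed.
Local Notation mL := measurable_likelihood_ratio.

Lemma measurable_likelihood_ratioT t : measurable_fun setT (L t).
Proof. by apply: (measurable_sub_sigmaW (G := F t)); exact: mL. Qed.
Local Notation mLT := measurable_likelihood_ratioT.

Lemma likelihood_ratio_integral t A : sub_sigma_sets (F t) A ->
  P1 A = \int[P0]_(x in A) (L t x)%:E.
Proof.
case: t => [|t] FA.
  (* Densities are given from time 1 on; at time 0 only the empty set and the whole space have to be
     checked. *)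
  case: LR => -> _; move: FA; rewrite filt_trivial => -[->|->].
    by rewrite measure0 integral_set0.
  by rewrite integral_probability1; exact: probability_setT.
have [_ /(_ t.+1 isT) Lt] := LR; have [dom _] := @standing t.+1 isT.
have mA : measurable (A : set (g_sigma_algebraType (F t.+1))).
  by rewrite sub_sigma_measurableE.
rewrite -(@integral_restr _ _ _ (F t.+1))//; last 2 first.
  by apply/measurable_EFinP; exact: mL.
  by move=> x; rewrite lee_fin L_ge0.
exact: is_density_integral dom Lt mA.
Qed.

Lemma likelihood_ratio_change_of_measure t (H : T -> \bar R) :
  measurable_wrt (F t) H -> (forall x, 0 <= H x) ->
  \int[P0]_x (H x * (L t x)%:E) = \int[P1]_x H x.
Proof.
exact: (ge0_integral_density (@mL t) (@L_ge0 t) (@likelihood_ratio_integral t)).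
Qed.

Lemma ae_likelihood_ratio t (Q : T -> Prop) :
  sub_sigma_sets (F t) [set x | ~ Q x] ->
  {ae P0, forall x, Q x} -> {ae P1, forall x, Q x}.
Proof. exact: (ae_density (@mL t) (@likelihood_ratio_integral t)). Qed.

Lemma measurable_lr_increment t :
  measurable_fun setT (Rt t.+1 : g_sigma_algebraType (F t.+1) -> R).
Proof.
have mLt : measurable_fun setT (L t : g_sigma_algebraType (F t.+1) -> R).
  apply: (measurable_sub_sigmaS (G := F t)); last exact: mL.
  exact: filt_nondecreasing.
apply: measurable_fun_ifT => //; first exact: measurable_fun_ltr.
rewrite (_ : (fun w => _) = (fun w => L t.+1 w * (L t w `^ (- 1)))%R).
  apply: measurable_funM; first exact: mL.
  exact: measurableT_comp (measurable_powR _) mLt.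
by apply/funext => w; rewrite powR_inv1// L_ge0.
Qed.

Lemma lr_increment_ge0 t w : (0 <= Rt t w)%R.
Proof. by rewrite /lr_increment; case: ifP => // _; rewrite divr_ge0// L_ge0. Qed.

(** The ratios telescope as long as [L] stays positive. Once [L t w] is 0, the induction hypothesis
    forces the product up to t to be 0, and it stays 0 whatever the later factors are. The bound
    thus holds at every point. *)
Lemma prod_lr_increment_le t w : (\prod_(1 <= n < t.+1) Rt n w <= L t w)%R.
Proof.
elim: t => [|t IH]; first by rewrite big_nil; case: LR => ->.
rewrite big_nat_recr//=; have [Lt0|Lt0] := ltP 0%R (L t w).
  rewrite {2}/lr_increment/= Lt0 mulrCA ler_piMr ?L_ge0//.
  by rewrite ler_pdivrMr// mul1r.
rewrite (_ : \prod_(1 <= i < t.+1) Rt i w = 0)%R ?mul0r ?L_ge0//.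
apply/eqP; rewrite eq_le (le_trans IH Lt0)/=.
by apply: prodr_ge0 => n _; exact: lr_increment_ge0.
Qed.

Variables (s : R) (Z : nat -> T -> \bar R).
Hypothesis s_gt0 : (0 < s)%R.
Local Notation beta := (1 + s)^-1%R.
Hypothesis HZ : is_Z F P0 L beta Z.

Let s1_gt0 : (0 < 1 + s)%R. Proof. by rewrite addr_gt0. Qed.

Let beta_gt0 : (0 < beta)%R. Proof. by rewrite invr_gt0. Qed.

Let measurable_lr_increment_powR t :
  measurable_fun setT (fun x => (Rt t.+1 x `^ beta)%:E).
Proof.
apply/measurable_EFinP; apply: measurableT_comp (measurable_powR _) _.
apply: (measurable_sub_sigmaW (G := F t.+1)).
exact: measurable_lr_increment.
Qed.

(** On A = {Z_(n+1) = 0} the increment is 0 almost surely, hence so is L_(n+1), and P1 A = 0. But P1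
    A is also the integral of L_n over A, so L_n = 0 almost surely on A, where the increment is 1 by
    convention: a contradiction off a null set. *)
Lemma ae_Z_gt0 n : {ae P0, forall x, 0 < Z n.+1 x}.
Proof.
have [mZ Z0 RZ] := HZ (isT : 0 < n.+1)%N.
pose A := [set x | Z n.+1 x <= 0].
have FA : sub_sigma_sets (F n) A.
  apply: mem_sub_sigma; rewrite -[A]setTI.
  by apply: emeasurable_fun_infty_c => //; exact: mZ.
have FA' : sub_sigma_sets (F n.+1) A.
  by apply: filt_nondecreasing FA.
have mA := sub_sigma_measurable FA.
have R0 : {ae P0, forall x, A x -> Rt n.+1 x = 0%R}.
  have : ae_eq P0 A (fun x => (Rt n.+1 x `^ beta)%:E) (cst 0).
    apply/ae_eq_integral_abs => //; first exact: measurable_funTS.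
    under eq_integral do rewrite gee0_abs ?lee_fin ?powR_ge0//.
    rewrite -RZ//; apply: integral0_eq => x Ax; apply/eqP.
    by rewrite eq_le Z0 andbT.
  apply: filterS => x /[apply] -[] /eqP; rewrite powR_eq0.
  by move=> /andP[/eqP].
have L0 : {ae P0, forall x, A x -> (L n x)%:E = 0}.
  apply/ae_eq_integral_abs => //.
    by apply/measurable_funTS/measurable_EFinP; exact: mLT.
  under eq_integral do rewrite gee0_abs ?lee_fin ?L_ge0//.
  rewrite -likelihood_ratio_integral// (likelihood_ratio_integral FA').
  rewrite -(integral0 P0 A); apply: ae_eq_integral => //.
    by apply/measurable_funTS/measurable_EFinP; exact: mLT.
  apply: filterS R0 => x + Ax => /(_ Ax); rewrite /lr_increment/=.
  case: ifP => [Ln0 /eqP|_ /eqP]; last by rewrite oner_eq0.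
  by rewrite mulf_eq0 invr_eq0 [X in _ || X]gt_eqF// orbF => /eqP ->.
apply: filterS2 R0 L0 => x R0 L0; rewrite ltNge; apply/negP => Ax.
have [Ln] := L0 Ax; have := R0 Ax; rewrite /lr_increment/= Ln ltxx => /eqP.
by rewrite oner_eq0.
Qed.

Lemma ae_Z_lty n : {ae P0, forall x, Z n.+1 x < +oo}.
Proof.
have [mZ Z0 RZ] := HZ (isT : 0 < n.+1)%N.
have mZT := measurable_sub_sigmaW mZ.
(* [g] is 1 / L_n, with value 0 where L_n = 0. Passing to [P1] at time n + 1 and back to [P0] at
   time n replaces L_(n+1) by L_n in the integral and bounds it by 1. The constant 2 in the
   domination below is 1 from [powR_le1D] plus 1 for the default value of the increment. *)
pose g x := (L n x `^ (- 1))%:E.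
have mg : measurable_wrt (F n) g.
  apply/measurable_EFinP; apply: measurableT_comp (measurable_powR _) _.
  exact: mL.
have mg' : measurable_wrt (F n.+1) g.
  by apply: (measurable_sub_sigmaS (G := F n)) mg; exact: filt_nondecreasing.
have g0 x : 0 <= g x by rewrite lee_fin powR_ge0.
have intgL : \int[P0]_x (g x * (L n.+1 x)%:E) <= 1.
  rewrite likelihood_ratio_change_of_measure//.
  rewrite -(likelihood_ratio_change_of_measure mg)//.
  rewrite -(integral_probability1 P0); apply: ge0_le_integral => //.
  - by move=> x _; rewrite mule_ge0// lee_fin L_ge0.
  - apply: emeasurable_funM; first exact: measurable_sub_sigmaW mg.
    by apply/measurable_EFinP; exact: mLT.
  - move=> x _; rewrite -EFinM lee_fin powR_inv1 ?L_ge0//.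
    have [->|Ln0] := eqVneq (L n x) 0%R; first by rewrite mulr0.
    by rewrite mulVf.
have mgL : measurable_fun setT (fun x => g x * (L n.+1 x)%:E).
  apply: emeasurable_funM; first exact: measurable_sub_sigmaW mg.
  by apply/measurable_EFinP; exact: mLT.
have gL0 x : 0 <= g x * (L n.+1 x)%:E by rewrite mule_ge0// lee_fin L_ge0.
have ZT : \int[P0]_x Z n.+1 x < +oo.
  rewrite RZ; last exact: sub_sigmaT.
  apply: (@le_lt_trans _ _ (\int[P0]_x (2%:E + g x * (L n.+1 x)%:E))).
    apply: ge0_le_integral => //.
    - by move=> x _; rewrite lee_fin powR_ge0.
    - exact: emeasurable_funD.
    move=> x _; rewrite -EFinM -EFinD lee_fin powR_inv1 ?L_ge0//.
    have Rb : (Rt n.+1 x `^ beta <= 1 + Rt n.+1 x)%R.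
      by apply: powR_le1D; rewrite ?lr_increment_ge0 ?(ltW beta_gt0)// invf_le1// lerDl ltW.
    apply: (le_trans Rb); rewrite /lr_increment/=; case: ifP => Ln.
      by rewrite mulrC lerD2r; lra.
    by rewrite lerDl mulr_ge0 ?invr_ge0 ?L_ge0.
  rewrite ge0_integralD// integral_cst// lte_add_pinfty//.
    by rewrite [X in _ * X](_ : _ = 1) ?mule1 ?ltry//; exact: probability_setT.
  by apply: (le_lt_trans intgL); exact: ltry.
have iZ : P0.-integrable setT (Z n.+1).
  by apply/integrableP; split => //; under eq_integral do rewrite gee0_abs//.
have := integrable_ae measurableT iZ.
by apply: filterS => x /(_ I); rewrite ge0_fin_numE.
Qed.

Local Notation z n w := (fine (Z n w)).

(* [z] is a junk value where [Z] is 0 or +oo, which is a [P0]-null event. *)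
Definition tilted_increment n w : \bar R := ((z n w)^-1 * Rt n w `^ beta)%:E.

Lemma tilted_increment_fair : is_fair_betting_sequence F P0 tilted_increment.
Proof.
case=> // n _; have [/= mZ Z0 RZ] := HZ (isT : 0 < n.+1)%N.
have mz : measurable_wrt (F n) (fun w => (z n.+1 w)^-1%:E).
  apply/measurable_EFinP.
  rewrite (_ : (fun w => _) = fun w => (z n.+1 w `^ (- 1))%R).
    apply: measurableT_comp (measurable_powR _) _.
    exact: measurableT_comp (fine_measurable _) mZ.
  by apply/funext => w; rewrite powR_inv1// fine_ge0.
have z0 w : 0 <= (z n.+1 w)^-1%:E by rewrite lee_fin invr_ge0 fine_ge0.
split.
- rewrite /tilted_increment /measurable_wrt.
  under eq_fun do rewrite EFinM.
  apply: emeasurable_funM.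
    by apply: (measurable_sub_sigmaS (G := F n)) mz; exact: filt_nondecreasing.
  apply/measurable_EFinP; apply: measurableT_comp (measurable_powR _) _.
  exact: measurable_lr_increment.
- move=> w; rewrite /tilted_increment EFinM mule_ge0//.
  by rewrite lee_fin powR_ge0.
(* Pulling out the [F n]-measurable factor yields this version of the conditional mean, which is 1
   exactly where Z is positive and finite. *)
- exists (fun w => (z n.+1 w)^-1%:E * Z n.+1 w).
    split=> [|w|A FA]; first exact: emeasurable_funM.
      by rewrite mule_ge0.
    under [RHS]eq_integral do rewrite /tilted_increment EFinM.
    apply/esym; apply: (@cond_exp_integralM _ _ _ _ (F n)) => //.
    by move=> w; rewrite lee_fin powR_ge0.
  apply: filterS2 (ae_Z_gt0 n) (ae_Z_lty n) => w Zgt0 Zlty.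
  have Zfin : Z n.+1 w \is a fin_num by rewrite ge0_fin_numE// ltW.
  rewrite -[X in _ * X](fineK Zfin) -EFinM mulVf// gt_eqF// fine_gt0//.
  by rewrite Zgt0.
Qed.

(** A real-valued stand-in for the exponential of the sum of the lambda_n, from which it differs
    only where some Z_n is 0 or +oo. With it the bound on the power of the tilted wealth holds
    everywhere, and measurability is immediate. *)
Let c t w : R := (\prod_(1 <= n < t.+1) z n w `^ (- (1 + s)))%R.

Let Z_ge0 n w : (0 < n)%N -> 0 <= Z n w.
Proof. by move=> /HZ[]. Qed.

Let prod_tilted t w : wealth tilted_increment t w =
  (\prod_(1 <= n < t.+1) ((z n w)^-1 * Rt n w `^ beta))%:E.
Proof. by rewrite -prodEFin. Qed.

Let tilted_powR_le t w :
  (fine (wealth tilted_increment t w) `^ (1 + s) <= L t w * c t w)%R.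
Proof.
have -> : (fine (wealth tilted_increment t w) `^ (1 + s) =
    (\prod_(1 <= n < t.+1) Rt n w) * c t w)%R.
  rewrite prod_tilted/= /c; elim: t => [|t IH].
    by rewrite !big_nil powR1 mulr1.
  have zR0 n : (0 < n)%N -> (0 <= (z n w)^-1 * Rt n w `^ beta)%R.
    by move=> n0; rewrite mulr_ge0 ?powR_ge0// invr_ge0 fine_ge0// Z_ge0.
  rewrite !(big_nat_recr t.+1)//= powRM ?zR0//; last first.
    rewrite big_nat; apply: prodr_ge0 => n; rewrite andbC => /andP[_ n0].
    exact: zR0.
  rewrite IH powRM ?powR_ge0 ?invr_ge0 ?fine_ge0 ?Z_ge0//.
  rewrite -powRrM mulVf ?gt_eqF// powRr1 ?lr_increment_ge0//.
  rewrite -powR_inv1 ?fine_ge0 ?Z_ge0// -powRrM mulN1r; ring.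
rewrite ler_wpM2r ?prod_lr_increment_le//.
by apply: prodr_ge0 => n _; exact: powR_ge0.
Qed.

Variable E : nat -> T -> \bar R.
Hypothesis betE : is_betting_sequence F P0 E.

Let mW t : measurable_fun setT (wealth E t).
Proof. exact: (measurable_sub_sigmaW (measurable_wealth (t := t) betE)). Qed.

Let W_ge0 t w : 0 <= wealth E t w.
Proof. exact: wealth_ge0 betE. Qed.

Let c_ge0 t w : (0 <= c t w)%R.
Proof. by apply: prodr_ge0 => n _; exact: powR_ge0. Qed.

Let mc t : measurable_wrt (F t) (fun w => (c t w)%:E).
Proof.
apply/measurable_EFinP; rewrite /c; elim: t => [|t IH].
  under eq_fun do rewrite big_nil; exact: measurable_cst.
under eq_fun do rewrite big_nat_recr//=.
apply: measurable_funM.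
  by apply: (measurable_sub_sigmaS (G := F t)) => //; exact: filt_nondecreasing.
apply: measurableT_comp (measurable_powR _) _.
apply: measurableT_comp (fine_measurable _) _ => //.
have [/= mZ _ _] := HZ (isT : 0 < t.+1)%N.
by apply: (measurable_sub_sigmaS (G := F t)) mZ; exact: filt_nondecreasing.
Qed.

Let mcW t : measurable_wrt (F t) (fun w => (c t w)%:E * neg_poweR (wealth E t w) s).
Proof.
apply: emeasurable_funM; first exact: mc.
by apply: measurable_neg_poweR => //; exact: (measurable_wealth betE).
Qed.

Let integral_cW t : 1 <= \int[P1]_w ((c t w)%:E * neg_poweR (wealth E t w) s).
Proof.
rewrite -(likelihood_ratio_change_of_measure (t := t))//; last first.
  by move=> w; rewrite mule_ge0 ?neg_poweR_ge0// lee_fin.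
have fD := tilted_increment_fair; have bD := fair_betting_sequence fD.
have mD := measurable_sub_sigmaW (measurable_wealth (t := t) bD).
have DE w : (fine (wealth tilted_increment t w))%:E = wealth tilted_increment t w.
  by rewrite fineK// prod_tilted.
have mDr : measurable_fun setT (fun w => fine (wealth tilted_increment t w)).
  exact: measurableT_comp (fine_measurable _) mD.
have D_ge0 w : (0 <= fine (wealth tilted_increment t w))%R.
  by rewrite fine_ge0//; exact: wealth_ge0 bD.
have := @young_expectation_ge1 _ _ _ P0 s (wealth E t) _ s_gt0 (mW t) (W_ge0 t)
   mDr D_ge0 (integral_wealth_le1 t betE).
have intD : \int[P0]_w (fine (wealth tilted_increment t w))%:E = 1.
  by under eq_integral do rewrite DE; exact: integral_fair_wealth fD.
move=> /(_ intD) /le_trans; apply.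
apply: ge0_le_integral => //.
- by move=> w _; rewrite mule_ge0 ?neg_poweR_ge0// lee_fin powR_ge0.
- apply: emeasurable_funM; last exact: measurable_neg_poweR.
  by apply/measurable_EFinP; exact: measurableT_comp (measurable_powR _) mDr.
- apply: emeasurable_funM; first by apply: (measurable_sub_sigmaW (G := F t)); exact: mcW.
  by apply/measurable_EFinP; exact: mLT.
- move=> w _; rewrite muleAC -EFinM lee_wpmul2r ?neg_poweR_ge0// lee_fin.
  by rewrite mulrC.
Qed.

Let ae_c t : {ae P1, forall w,
  (c t w)%:E = expeR (\sum_(1 <= n < t.+1) lambda_of beta (Z n w))}.
Proof.
elim: t => [|t IH].
  by apply: aeW => w; rewrite /c !big_nil expeR0.
have Z01 : {ae P1, forall w, 0 < Z t.+1 w < +oo}.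
  (* The transfer takes place at time t, not t + 1, since Z_(t+1) is [F t]-measurable. *)
  apply: (@ae_likelihood_ratio t).
    have [mZ _ _] := HZ (isT : 0 < t.+1)%N.
    rewrite (_ : [set x | _] = [set x | Z t.+1 x <= 0] `|` [set x | +oo <= Z t.+1 x]).
      apply: mem_sub_sigma; apply: measurableU; rewrite -[X in measurable X]setTI.
        by apply: emeasurable_fun_infty_c => //; exact: mZ.
      by apply: emeasurable_fun_c_infty => //; exact: mZ.
    apply/seteqP; split => x /=.
      by move/negP; rewrite negb_and -!leNgt => /orP.
    by move=> /orP; rewrite !leNgt -negb_and => /negP.
  by apply: filterS2 (ae_Z_gt0 t) (ae_Z_lty t) => w -> ->.
apply: filterS2 IH Z01 => w IH /andP[Z0 Zoo].
rewrite /c !(big_nat_recr t.+1)//= EFinM IH expeRD; congr (_ * _).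
have Zfin : Z t.+1 w \is a fin_num by rewrite ge0_fin_numE// ltW.
rewrite -{2}(fineK Zfin) expeR_lambda_of// fine_gt0//.
by rewrite Z0.
Qed.

Lemma tilted_wealth_ge1 t :
  1 <= \int[P1]_w (neg_poweR (wealth E t w) s *
         expeR (\sum_(1 <= n < t.+1) lambda_of beta (Z n w))).
Proof.
apply: (le_trans (integral_cW t)); apply: ae_le_integral_lower.
- by apply: (measurable_sub_sigmaW (G := F t)); exact: mcW.
- by move=> w; rewrite mule_ge0 ?neg_poweR_ge0// lee_fin.
- by move=> w; rewrite mule_ge0 ?neg_poweR_ge0// expeR_ge0.
- by apply: filterS (ae_c t) => w ->; rewrite muleC.
Qed.

Lemma Lambda_le_mean (lambda_bar : nat -> \bar R) t :
  (forall n, (0 < n)%N -> 0 <= lambda_bar n) ->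
  (forall n, (0 < n)%N ->
    {ae P1, forall w, lambda_of beta (Z n w) <= lambda_bar n}) ->
  (0 < t)%N ->
  Lambda P1 E s t <= (t%:R^-1)%:E * \sum_(1 <= n < t.+1) lambda_bar n.
Proof.
move=> lb0 lb t0.
have tV0 : (0 < t%:R^-1 :> R)%R by rewrite invr_gt0 ltr0n.
have : 0 <= \sum_(1 <= n < t.+1) lambda_bar n.
  by rewrite big_nat; apply: sume_ge0 => n /andP[n0 _]; exact: lb0.
have : {ae P1, forall w, (c t w)%:E <= expeR (\sum_(1 <= n < t.+1) lambda_bar n)}.
  have : {ae P1, forall w, \sum_(1 <= n < t.+1) lambda_of beta (Z n w) <=
      \sum_(1 <= n < t.+1) lambda_bar n}.
    elim: (t) => [|k IH]; first by apply: aeW => w; rewrite !big_nil.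
    apply: filterS2 IH (lb k.+1 isT) => w IH lbk.
    by rewrite !(big_nat_recr k.+1)//= leeD.
  by apply: filterS2 (ae_c t) => w -> ?; rewrite lee_expeR.
(* If some [lambda_bar n] is +oo the bound is trivial; otherwise [le_Lambda] applies with a = S /
   t. *)
case: (\sum_(1 <= n < t.+1) lambda_bar n) => [S||]//= cS S0; last first.
  by rewrite gt0_muley ?leey.
rewrite -EFinM; apply: le_Lambda => //.
rewrite mulrA mulfV ?mul1r ?gt_eqF ?ltr0n//.
apply: (le_trans (integral_cW t)).
have mN : measurable_fun setT (fun w => neg_poweR (wealth E t w) s).
  exact: measurable_neg_poweR.
rewrite -ge0_integralZl_EFin ?expR_ge0//; last first.
  by move=> w _; exact: neg_poweR_ge0.
apply: ae_ge0_le_integral => //.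
- by move=> w _; rewrite mule_ge0 ?neg_poweR_ge0// lee_fin.
- by apply: (measurable_sub_sigmaW (G := F t)); exact: mcW.
- by move=> w _; rewrite mule_ge0 ?neg_poweR_ge0// lee_fin expR_ge0.
- exact: measurable_funeM.
- by apply: filterS cS => w cS _; rewrite lee_wpmul2r ?neg_poweR_ge0.
Qed.

End general_model.

(** * The i.i.d. model *)

Section weighted_measure.
Context d (T : measurableType d) (R : realType) (mu : {measure set T -> \bar R}).
Variable f : T -> \bar R.
Hypotheses (mf : measurable_fun setT f) (f_ge0 : forall x, 0 <= f x).

(** The measure with density [f]. The proofs are arguments so that the measure structure can be
    attached to the term [weighted_measure mf f_ge0]. *)
Definition weighted_measure
    & measurable_fun setT f & (forall x, 0 <= f x) : set T -> \bar R :=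
  fun A => \int[mu]_(x in A) f x.

Local Notation nu := (weighted_measure mf f_ge0).

Let nu0 : nu set0 = 0.
Proof. exact: integral_set0. Qed.

Let nu_ge0 A : 0 <= nu A.
Proof. exact: integral_ge0. Qed.

Let nu_sigma_additive : semi_sigma_additive nu.
Proof.
move=> F mF tF mUF; rewrite /weighted_measure ge0_integral_bigcup//; last first.
  exact: measurable_funTS.
by apply: is_cvg_ereal_nneg_natsum => n _; exact: integral_ge0.
Qed.

HB.instance Definition _ := isMeasure.Build _ _ _ nu
  nu0 nu_ge0 nu_sigma_additive.

End weighted_measure.

(** * Cylinders, independence and conditional expectations on the sequence space *)

Section sequence_space.
Context d (X : measurableType d) (R : realType).
Local Notation F := (iid_filtration X).

Lemma measurable_coordinate n t : (n < t)%N ->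
  measurable_fun setT ((fun w => w n) : g_sigma_algebraType (F t) -> X).
Proof.
move=> nt _ B mB; rewrite sub_sigma_measurableE; apply: sub_sigma_algebra.
by rewrite (bigD1 (Ordinal nt))//=; left; exists B.
Qed.

Lemma measurable_coordinateT n : measurable_fun setT (fun w : seqspace X => w n).
Proof.
apply: (measurable_sub_sigmaW (G := F n.+1)); exact: measurable_coordinate.
Qed.

Definition cylinder (t : nat) (A : nat -> set X) : set (seqspace X) :=
  [set w | forall i, (i < t)%N -> A i (w i)].

Lemma cylinderS t A :
  cylinder t.+1 A = cylinder t A `&` [set w | A t (w t)].
Proof.
apply/seteqP; split => [w Aw|w [Aw At] i].
  by split; [move=> i it; exact/Aw/ltnW|exact/Aw/ltnSn].
by rewrite ltnS leq_eqVlt => /predU1P[->//|]; exact: Aw.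
Qed.

Lemma cylinder_set t A : (forall i, measurable (A i)) ->
  sub_sigma_sets (F t) (cylinder t A).
Proof.
move=> mA; apply: mem_sub_sigma.
rewrite (_ : cylinder t A =
    \bigcap_(i in [set k | (k < t)%N]) (setT `&` (fun w => w i) @^-1` A i)).
  by apply: bigcap_measurableType => i it; exact: measurable_coordinate.
apply/seteqP; split => [w Aw i /= it|w Aw i it]; first by split => //; exact: Aw.
by have [] := Aw i it.
Qed.

(** Cylinders of length t are stable under intersection, contain the whole space and generate [F t]:
    an event on a single coordinate is the cylinder whose other factors are [setT]. *)
Lemma coordinates_measure_unique t (m1 m2 : {measure set (seqspace X) -> \bar R}) :
  (forall A, (forall i, measurable (A i)) ->
    m1 (cylinder t A) = m2 (cylinder t A)) ->
  m1 setT < +oo ->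
  forall B, sub_sigma_sets (F t) B -> m1 B = m2 B.
Proof.
move=> m12 m1oo B FB.
pose C : set (set (seqspace X)) := [set cylinder t A | A in
  [set A : nat -> set X | forall i, measurable (A i)]].
have CF : C `<=` sub_sigma_sets (F t) by move=> _ [A mA <-]; exact: cylinder_set.
have CT : C setT.
  exists (fun=> setT); first by move=> i; exact: measurableT.
  by apply/seteqP; split.
apply: (@g_sigma_algebra_measure_unique _ _ _ C _ (fun=> setT)).
- by move=> A /CF; exact: sub_sigma_measurable.
- by [].
- by rewrite bigcup_const//; exists 0%N.
- move=> _ _ [A mA <-] [A' mA' <-]; exists (fun i => A i `&` A' i).
    by move=> i; exact: measurableI.
  apply/seteqP; split => [w AA'|w [Aw A'w] i it].
    by split=> i /AA'[].
  by split; [exact: Aw|exact: A'w].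
- by move=> _ [A mA <-]; exact: m12.
- by [].
- move: FB; apply: sub_sigma_algebra2; apply: (big_ind (fun A => A `<=` _)) => //.
    by move=> A A' AC A'C; rewrite subUset.
  move=> i _ _ [A mA <-]; exists (fun j : nat => if j == i then A else setT).
    by move=> j; case: ifP.
  apply/seteqP; split => [w Aw|w [_ Aw] j jt].
    by split => //; have := Aw i (ltn_ord i); rewrite eqxx.
  by case: eqP => // ->.
Qed.

Definition coordinate_sigma (t : nat) : sub_sigma (seqspace X).
Proof.
exists (preimage_set_system setT (fun w : seqspace X => w t) measurable).
  exact/sigma_algebra_preimage/sigma_algebra_measurable.
by move=> _ [B mB <-]; exact: measurable_coordinateT.
Defined.

Section countable_power.
Variables (P : probability X R) (PP : probability (seqspace X) R).
Hypothesis powerP : is_countable_power P PP.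

Lemma countable_power_coordinate n B : measurable B ->
  PP [set w | B (w n)] = P B.
Proof.
move=> mB; pose A i := if i == n then B else setT.
have : PP (cylinder n.+1 A) = _ := powerP n.+1 (A := A) _.
rewrite cylinderS (_ : [set w | A n _] = [set w | B (w n)]); last first.
  by rewrite /A eqxx.
rewrite (_ : cylinder n _ = setT) ?setTI; last first.
  by apply/seteqP; split => // w _ i ni; rewrite /A ltn_eqF.
move=> -> => [|i]; last by rewrite /A; case: ifP.
rewrite big_ord_recr/= {2}/A eqxx big1 ?mul1e// => i _.
by rewrite /A ltn_eqF//; exact: probability_setT.
Qed.

(** [F t] sees the indices below t, so [w t] is the next observation. As functions of [A] both sides
    are finite measures, [PP] restricted to {w t in B} and a multiple of [PP]; they agree on
    cylinders of length t. *)
Lemma countable_power_indep t A B : sub_sigma_sets (F t) A -> measurable B ->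
  PP (A `&` [set w | B (w t)]) = PP A * P B.
Proof.
move=> FA mB.
have mtB : measurable ([set w | B (w t)] : set (seqspace X)).
  by rewrite -[X in measurable X]setTI; exact: measurable_coordinateT.
have PB : ((fine (P B))%:E = P B) by rewrite fineK// fin_num_measure.
have PB0 : (0 <= fine (P B))%R by rewrite fine_ge0.
have := @coordinates_measure_unique t (mrestr PP mtB) (mscale (NngNum PB0) PP).
rewrite /= /mrestr/= /mscale/= PB muleC.
move=> -> //.
- move=> A' mA'; rewrite powerP//.
  pose A'' i := if i == t then B else A' i.
  rewrite (_ : _ `&` _ = cylinder t.+1 A''); last first.
    rewrite cylinderS /A'' eqxx; congr (_ `&` _).
    by apply/seteqP; split => w Aw i it; have := Aw i it; rewrite ltn_eqF.
  rewrite powerP => [|i]; last by rewrite /A''; case: ifP.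
  rewrite big_ord_recr/= /A'' eqxx muleC; congr (_ * _).
  by apply: eq_bigr => i _; rewrite ltn_eqF.
- by rewrite setTI ltey_eq fin_num_measure.
Qed.

Lemma integral_coordinate t (f : X -> \bar R) :
  measurable_fun setT f -> (forall x, 0 <= f x) ->
  \int[PP]_w f (w t) = \int[P]_x f x.
Proof.
move=> mf f0.
have := @ge0_integral_pushforward _ _ _ _ R _ (measurable_coordinateT t) PP setT f
  measurableT mf (fun y _ => f0 y).
rewrite preimage_setT => <-; apply: eq_measure_integral => [|mt A mA _].
  exact: measurable_coordinateT.
exact: countable_power_coordinate.
Qed.

Lemma countable_power_integral_indep t A (f : X -> \bar R) :
  sub_sigma_sets (F t) A -> measurable_fun setT f -> (forall x, 0 <= f x) ->
  \int[PP]_(w in A) f (w t) = PP A * \int[P]_x f x.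
Proof.
move=> FA mf f0; have mA := sub_sigma_measurable FA.
transitivity (\int[PP]_w (f (w t) * (\1_A w)%:E)).
  rewrite integral_mkcond; apply: eq_integral => w _.
  by rewrite epatch_indic.
transitivity (\int[PP]_w (f (w t) * cst (PP A) w)).
  (* the roles are exchanged: [f (w t)] is the measurable factor, [\1_A] the
     integrand with conditional expectation [PP A] given the coordinate [w t] *)
  apply: (@ge0_integralM_eq _ _ _ _ _ (coordinate_sigma t)) => //.
  - by apply/measurable_EFinP; exact: measurable_indic.
  - move=> _ [B mB <-]; rewrite setTI.
    have mtB : measurable ([set w | B (w t)] : set (seqspace X)).
      by rewrite -[X in measurable X]setTI; exact: measurable_coordinateT.
    rewrite integral_indic// integral_cst//.
    transitivity (PP A * P B); first exact: countable_power_indep.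
    by congr (_ * _); exact/esym/countable_power_coordinate.
  - move=> _ C mC; rewrite sub_sigma_measurableE.
    by exists (f @^-1` C) => //; rewrite -[_ @^-1` _]setTI; exact: mf.
under eq_integral do rewrite /= muleC.
rewrite ge0_integralZl//; first by rewrite integral_coordinate.
- exact: measurableT_comp mf (measurable_coordinateT t).
Qed.

Lemma countable_power_cond_exp t (f : X -> \bar R) :
  measurable_fun setT f -> (forall x, 0 <= f x) ->
  is_cond_exp PP (F t) (fun w => f (w t)) (cst (\int[P]_x f x)).
Proof.
move=> mf f0; split => [|w|A FA]; first exact: measurable_cst.
  exact: integral_ge0.
rewrite countable_power_integral_indep// muleC.
exact: integral_cst (sub_sigma_measurable FA) _.
Qed.

End countable_power.
End sequence_space.

(** Both sides are false when the integral is 0 or +oo, because [Lambda] is then infinite while [a]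
    is real. *)
Lemma Lambda_eqP d (T : measurableType d) (R : realType) (P : probability T R)
    (E : nat -> T -> \bar R) (s a : R) (t : nat) : (0 < t)%N ->
  Lambda P E s t = a%:E <->
  (expR (t%:R * a))%:E * \int[P]_w neg_poweR (wealth E t w) s = 1.
Proof.
move=> t0; rewrite /Lambda.
have : 0 <= \int[P]_w neg_poweR (wealth E t w) s.
  by apply: integral_ge0 => w _; exact: neg_poweR_ge0.
have tR0 : (0 < t%:R :> R)%R by rewrite ltr0n.
have tV0 : (0 < t%:R^-1 :> R)%R by rewrite invr_gt0.
case: (\int[P]_w _) => [i||]//; last first.
  by move=> _; rewrite /= !gt0_muley ?lte_fin ?expR_gt0.
rewrite lee_fin le_eqVlt => /predU1P[<-|i0].
  rewrite mule0 le0_lneNy// gt0_muleNy ?lte_fin//.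
  by split=> [//|/eqP]; rewrite eqe eq_sym oner_eq0.
rewrite lne_EFin// -EFinM -EFinN -EFinM.
split=> [[<-]|[h]]; congr EFin.
  rewrite mulrN mulrA mulfV ?gt_eqF// mul1r expRN lnK ?posrE// mulVf//.
  by rewrite gt_eqF.
have -> : i = expR (- (t%:R * a)).
  apply: (mulfI (negbT (gt_eqF (expR_gt0 (t%:R * a)%R)))).
  by rewrite h expRN mulfV// gt_eqF ?expR_gt0.
by rewrite expRK mulrN opprK mulrA mulVf ?gt_eqF// mul1r.
Qed.

(** * The bound and its equality case for i.i.d. observations *)

Section iid_model.
Context d (X : measurableType d) (R : realType).
Variables (P0 P1 : probability X R) (PP0 PP1 : probability (seqspace X) R).
Hypotheses (power0 : is_countable_power P0 PP0)
  (power1 : is_countable_power P1 PP1) (dom : P1 `<< P0).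
Variable r : X -> R.
Hypothesis densr : is_density P1 P0 r.
Variable s : R.
Hypothesis s_gt0 : (0 < s)%R.

Local Notation F := (iid_filtration X).
Local Notation beta := (1 + s)^-1%R.
Local Notation z := (fine (iid_Z P0 r beta)).

Let s1_gt0 : (0 < 1 + s)%R. Proof. by rewrite addr_gt0. Qed.

Let beta_gt0 : (0 < beta)%R. Proof. by rewrite invr_gt0. Qed.

Let mr : measurable_fun setT r. Proof. by case: densr. Qed.

Let r_ge0 x : (0 <= r x)%R. Proof. by case: densr. Qed.

Let mrE : measurable_fun setT (fun x => (r x)%:E).
Proof. exact/measurable_EFinP. Qed.

Let P1E A : measurable A -> P1 A = \int[P0]_(x in A) (r x)%:E.
Proof. exact: is_density_integral. Qed.

Let intr : \int[P0]_x (r x)%:E = 1.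
Proof. by rewrite -P1E//; exact: probability_setT. Qed.

Let mrb : measurable_fun setT (fun x => (r x `^ beta)%:E).
Proof. by apply/measurable_EFinP; exact: measurableT_comp (measurable_powR _) mr. Qed.

Let iid_Z_lty : iid_Z P0 r beta < +oo.
Proof.
apply: (@le_lt_trans _ _ (\int[P0]_x (1 + (r x)%:E))).
  apply: ge0_le_integral => //.
  - by move=> x _; rewrite lee_fin powR_ge0.
  - exact: emeasurable_funD.
  - move=> x _; rewrite -EFinD lee_fin powR_le1D ?(ltW beta_gt0)//.
    by rewrite invf_le1// lerDl ltW.
rewrite ge0_integralD//; last by move=> x _; rewrite lee_fin.
by rewrite integral_probability1 intr ltry.
Qed.

Let iid_Z_gt0 : 0 < iid_Z P0 r beta.
Proof.
rewrite lt_neqAle integral_ge0 ?andbT; last first.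
  by move=> x _; rewrite lee_fin powR_ge0.
apply/eqP => Z0; have : ae_eq P0 setT (fun x => (r x `^ beta)%:E) (cst 0).
  apply/ae_eq_integral_abs => //; rewrite Z0.
  by apply: eq_integral => x _; rewrite gee0_abs// lee_fin powR_ge0.
move=> r0; have : \int[P0]_x (r x)%:E = \int[P0]_x 0.
  apply: ae_eq_integral => //; apply: filterS r0 => x /(_ I)[] /eqP + _.
  by rewrite powR_eq0 => /andP[/eqP ->].
by rewrite intr integral0 => /eqP; rewrite eqe oner_eq0.
Qed.

Let zE : iid_Z P0 r beta = z%:E.
Proof. by rewrite fineK// ge0_fin_numE// ltW. Qed.

Let z_gt0 : (0 < z)%R.
Proof. by rewrite fine_gt0// iid_Z_gt0. Qed.

(** The likelihood ratio of the powers on [F t], as an explicit product instead of a Radon-Nikodym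
    derivative. This keeps the relation between [L] and the power of [D] an identity at every
    point. *)
Let L t (w : seqspace X) : R := (\prod_(1 <= n < t.+1) r (coordinate n w))%R.

Let L_ge0 t w : (0 <= L t w)%R.
Proof. by apply: prodr_ge0. Qed.

Let L0 : L 0 = cst 1%R.
Proof. by apply/funext => w; rewrite /L big_nil. Qed.

Let LS t : L t.+1 = (fun w => L t w * r (w t))%R.
Proof. by apply/funext => w; rewrite /L big_nat_recr. Qed.

Let mL t : measurable_fun setT (L t : g_sigma_algebraType (F t) -> R).
Proof.
elim: t => [|t IH]; first by rewrite L0; exact: measurable_cst.
rewrite LS; apply: measurable_funM.
  apply: (measurable_sub_sigmaS (G := F t)) => //.
  exact: (@filt_nondecreasing _ _ F _ _ (leqnSn t)).
exact: measurableT_comp mr (measurable_coordinate (ltnSn t)).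
Qed.

Let mLE t : measurable_fun setT (fun w : seqspace X => (L t w)%:E).
Proof. by apply/measurable_EFinP; apply: (measurable_sub_sigmaW (G := F t)). Qed.

Let LE_ge0 t w : 0 <= (L t w)%:E. Proof. by rewrite lee_fin. Qed.

(** The last coordinate is integrated out: given [F t], the factor r 1_(A t) evaluated at [w t] has
    constant conditional mean P1 (A t). *)
Let integral_L_cylinder t A : (forall i, measurable (A i)) ->
  \int[PP0]_(w in cylinder t A) (L t w)%:E = \prod_(i < t) P1 (A i).
Proof.
move=> mA; elim: t => [|t IH].
  rewrite big_ord0 (_ : cylinder 0 A = setT); last by apply/seteqP; split.
  by rewrite L0; exact: integral_probability1.
rewrite big_ord_recr/= -IH.
have FA : sub_sigma_sets (F t) (cylinder t A) by exact: cylinder_set.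
pose f x : \bar R := (r x)%:E * (\1_(A t) x)%:E.
have mf : measurable_fun setT f.
  by apply: emeasurable_funM => //; apply/measurable_EFinP; exact: measurable_indic.
have f0 x : 0 <= f x by rewrite mule_ge0// lee_fin.
transitivity (\int[PP0]_(w in cylinder t A) ((L t w)%:E * f (w t))).
  rewrite cylinderS integral_mkcondr; apply: eq_integral => w _.
  rewrite epatch_indic LS EFinM -muleA; congr (_ * (_ * _)).
rewrite (cond_exp_integralM _ _ (countable_power_cond_exp power0 t mf f0))//.
- under eq_integral do rewrite muleC.
  rewrite ge0_integralZl//; first 1 last.
  - exact: sub_sigma_measurable FA.
  - exact: measurable_funTS.
  - exact: integral_ge0.
  rewrite muleC P1E//; congr (_ * _).
  by rewrite [RHS]integral_mkcond; apply: eq_integral => x _; rewrite epatch_indic.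
- exact: measurableT_comp mf (measurable_coordinateT t).
- by apply/measurable_EFinP; exact: mL.
Qed.

Let PP1E t A : sub_sigma_sets (F t) A -> PP1 A = \int[PP0]_(w in A) (L t w)%:E.
Proof.
move=> FA; apply: (@coordinates_measure_unique _ _ _ t PP1
  (weighted_measure PP0 (mLE t) (LE_ge0 t)) _ _ _ FA).
  by move=> A' mA'; rewrite /= /weighted_measure integral_L_cylinder// power1.
by rewrite ltey_eq fin_num_measure.
Qed.

Let k : R := (z `^ (- (1 + s)))%R.

Let lam : R := (- (1 + s) * ln z)%R.

Let expR_lam t : expR (t%:R * lam) = (k ^+ t)%R.
Proof. by rewrite mulrC expRM_natr /k /powR gt_eqF. Qed.

Lemma lambda_of_iid_Z : lambda_of beta (iid_Z P0 r beta) = lam%:E.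
Proof. by rewrite zE /lambda_of lne_EFin// invrK -EFinM -EFinN /lam mulNr. Qed.

Let rho n (w : seqspace X) := tilted_ratio P0 r beta (coordinate n w).

Let tiltedE x : tilted_ratio P0 r beta x = (r x `^ beta / z)%:E.
Proof. by rewrite /tilted_ratio zE inver gt_eqF. Qed.

Let mtilted : measurable_fun setT (tilted_ratio P0 r beta).
Proof.
rewrite (_ : tilted_ratio _ _ _ = fun x => (r x `^ beta / z)%:E); last first.
  by apply/funext => x; exact: tiltedE.
by apply/measurable_EFinP; apply: measurable_funM => //; exact/measurable_EFinP.
Qed.

Let tilted_ge0 x : 0 <= tilted_ratio P0 r beta x.
Proof. by rewrite tiltedE lee_fin divr_ge0 ?powR_ge0// ltW. Qed.

Let integral_tilted : \int[P0]_x tilted_ratio P0 r beta x = 1.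
Proof.
under eq_integral do rewrite tiltedE mulrC EFinM.
rewrite ge0_integralZl_EFin//; last 2 first.
  by move=> x _; rewrite lee_fin powR_ge0.
  by rewrite invr_ge0 ltW.
by rewrite -/(iid_Z P0 r beta) zE -EFinM mulVf// gt_eqF.
Qed.

Lemma measurable_tilted_coordinate n : (0 < n)%N ->
  measurable_wrt (F n) (fun w => tilted_ratio P0 r beta (coordinate n w)).
Proof.
case: n => // n _.
exact: measurableT_comp mtilted (measurable_coordinate (ltnSn n)).
Qed.

Let rho_fair : is_fair_betting_sequence F PP0 rho.
Proof.
case=> // n _; split.
- exact: measurable_tilted_coordinate.
- by move=> w; exact: tilted_ge0.
- exists (cst (\int[P0]_x tilted_ratio P0 r beta x)).
    exact: (countable_power_cond_exp power0 n mtilted tilted_ge0).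
  by apply: aeW => w; exact: integral_tilted.
Qed.

Let rho_betting := fair_betting_sequence rho_fair.

Let D t (w : seqspace X) : R := (\prod_(1 <= n < t.+1) (r (coordinate n w) `^ beta / z))%R.

Let wealth_rho t w : wealth rho t w = (D t w)%:E.
Proof. by rewrite /D -prodEFin; apply: eq_bigr => n _; exact: tiltedE. Qed.

Let D_ge0 t w : (0 <= D t w)%R.
Proof. by apply: prodr_ge0 => n _; rewrite divr_ge0 ?powR_ge0// ltW. Qed.

Let mD t : measurable_fun setT (D t).
Proof.
apply/measurable_EFinP; rewrite (_ : EFin \o D t = wealth rho t); last first.
  by apply/funext => w; rewrite wealth_rho.
apply: (measurable_sub_sigmaW (G := F t)).
exact: (measurable_wealth (F := F) rho_betting).
Qed.

Let intD t : \int[PP0]_w (D t w)%:E = 1.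
Proof.
by under eq_integral do rewrite -wealth_rho; exact: integral_fair_wealth rho_fair.
Qed.

Let D_powR t w : (D t w `^ (1 + s) = L t w * k ^+ t)%R.
Proof.
rewrite /D /L; elim: t => [|t IH]; first by rewrite !big_nil powR1 mulr1.
rewrite !(big_nat_recr t.+1)//= powRM ?D_ge0//; last first.
  by rewrite divr_ge0 ?powR_ge0// ltW.
rewrite IH powRM ?powR_ge0 ?invr_ge0 ?ltW// -powRrM mulVf ?gt_eqF// powRr1//.
rewrite -powR_inv1 ?ltW// -powRrM mulN1r exprSr -/k; ring.
Qed.

Let change_of_measure t (H : seqspace X -> \bar R) :
  measurable_wrt (F t) H -> (forall w, 0 <= H w) ->
  \int[PP0]_w (H w * (L t w)%:E) = \int[PP1]_w H w.
Proof. exact: (ge0_integral_density (@mL t) (L_ge0 t) (@PP1E t)). Qed.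

Let k_ge0 : (0 <= k)%R. Proof. exact: powR_ge0. Qed.

(** The quantity in Young's inequality is exactly the one in [Lambda], so bound and equality case
    carry over without loss. [W] is arbitrary because the converse direction takes [W] = [D]. *)
Let young_integrand W t :
  measurable_wrt (F t) W -> (forall w, 0 <= W w) ->
  \int[PP0]_w ((D t w `^ (1 + s))%:E * neg_poweR (W w) s) =
  (expR (t%:R * lam))%:E * \int[PP1]_w neg_poweR (W w) s.
Proof.
move=> mW W0; have mN : measurable_wrt (F t) (fun w => neg_poweR (W w) s).
  exact: measurable_neg_poweR.
rewrite -(change_of_measure (t := t))//; last by move=> w; exact: neg_poweR_ge0.
rewrite expR_lam -ge0_integralZl_EFin//.
- by apply: eq_integral => w _; rewrite D_powR mulrC EFinM -muleA [X in _ * X]muleC.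
- by move=> w _; rewrite mule_ge0 ?neg_poweR_ge0.
- apply: emeasurable_funM => //.
  by apply: (measurable_sub_sigmaW (G := F t)); exact: mN.
- exact: exprn_ge0.
Qed.

Variable E : nat -> seqspace X -> \bar R.
Hypothesis betE : is_betting_sequence F PP0 E.

Let mW t : measurable_wrt (F t) (wealth E t).
Proof. exact: measurable_wealth betE. Qed.

Let mWT t : measurable_fun setT (wealth E t).
Proof. by apply: (measurable_sub_sigmaW (G := F t)); exact: mW. Qed.

Let W_ge0 t w : 0 <= wealth E t w.
Proof. exact: wealth_ge0 betE. Qed.

Lemma iid_Lambda_le t : (0 < t)%N ->
  Lambda PP1 E s t <= lambda_of beta (iid_Z P0 r beta).
Proof.
move=> t0; rewrite lambda_of_iid_Z; apply: le_Lambda => //.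
rewrite -young_integrand//; apply: young_expectation_ge1 => //.
exact: integral_wealth_le1 betE.
Qed.

Let sub_sigma_neq n (f g : seqspace X -> \bar R) :
  measurable_wrt (F n) f -> measurable_wrt (F n) g ->
  sub_sigma_sets (F n) [set w | ~ f w = g w].
Proof.
move=> mf mg; apply: mem_sub_sigma.
rewrite (_ : [set w | _] = setT `&` [set w | f w != g w]).
  exact: measurable_neqe.
by rewrite setTI; apply/seteqP; split => w /= /eqP.
Qed.

(** The comparison backwards in time uses the martingale property under [PP0]; only afterwards is
    the [F n]-event of inequality moved to [PP1]. *)
Let wealth_eq_ae t n : ae_eq PP0 setT (wealth E t) (wealth rho t) ->
  (n <= t)%N -> {ae PP1, forall w, wealth E n w = wealth rho n w}.
Proof.
move=> WD nt.
apply: (ae_density (@mL n) (@PP1E n)).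
  by apply: sub_sigma_neq => //; exact: (measurable_wealth (F := F) rho_betting).
apply: filterS (ae_eq_wealth_le betE rho_fair nt WD) => w; exact.
Qed.

Let D_gt0 n : {ae PP1, forall w, (0 < D n w)%R}.
Proof.
apply: filterS (ae_density_gt0 (@mL n) (L_ge0 n) (@PP1E n)) => w Lw.
rewrite lt_neqAle D_ge0 andbT; apply/eqP => D0.
have := D_powR n w; rewrite -D0 powR0 ?gt_eqF// => /esym/eqP.
by rewrite mulf_eq0 !gt_eqF// exprn_gt0// powR_gt0.
Qed.

Lemma iid_Lambda_eqP t : (0 < t)%N ->
  Lambda PP1 E s t = lambda_of beta (iid_Z P0 r beta) <->
  (forall n, (0 < n <= t)%N -> {ae PP1, forall w,
     E n w = tilted_ratio P0 r beta (coordinate n w)}).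
Proof.
move=> t0; rewrite lambda_of_iid_Z Lambda_eqP// -young_integrand//.
split=> [N1 n /andP[n0 nt]|Erho].
  have WD : ae_eq PP0 setT (wealth E t) (wealth rho t).
    rewrite (_ : wealth rho t = EFin \o D t); last first.
      by apply/funext => w; exact: wealth_rho.
    apply: (@young_expectation_eq _ _ _ _ s) => //.
      exact: integral_wealth_le1 betE.
    by rewrite N1.
  case: n n0 nt => // n _ nt.
  have Wn := wealth_eq_ae WD (ltnW nt); have Wn1 := wealth_eq_ae WD nt.
  apply: filterS3 (D_gt0 n) Wn Wn1 => w Dw; rewrite !wealthS => ->.
  rewrite wealth_rho => /eqP.
  by rewrite eq_le !lee_pmul2l ?lte_fin// -eq_le => /eqP.
have WD : {ae PP1, forall w, wealth E t w = (D t w)%:E}.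
  suff : forall n, (n <= t)%N -> {ae PP1, forall w, wealth E n w = wealth rho n w}.
    by move=> /(_ t (leqnn t)); apply: filterS => w ->.
  elim=> [|n IH] nt; first by apply: aeW => w; rewrite !wealth0.
  apply: filterS2 (IH (ltnW nt)) (Erho n.+1 nt) => w.
  by rewrite !wealthS => -> ->.
have mDw : measurable_wrt (F t) (fun w => (D t w)%:E).
  rewrite (_ : (fun w => _) = wealth rho t).
    exact: (measurable_wealth (F := F) rho_betting).
  by apply/funext => w; rewrite wealth_rho.
have D0 w : 0 <= (D t w)%:E by rewrite lee_fin.
(* The bets are known only [PP1]-a.s., so [D] replaces the wealth under [PP1], and the identity is
   then read back under [PP0]. There the integrand becomes [D] itself, also where [D] = 0 by 0 * oo
   = 0, and has integral 1. *)
rewrite young_integrand// (_ : \int[PP1]_w _ = \int[PP1]_w neg_poweR (D t w)%:E s).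
  rewrite -young_integrand// -(intD t); apply: eq_integral => w _.
  have [/eqP D00|Dn0] := eqVneq (D t w) 0%R.
    by move/eqP: D00 => ->; rewrite powR0 ?mul0e// gt_eqF.
  have Dgt0 : (0 < D t w)%R by rewrite lt_neqAle eq_sym Dn0 D_ge0.
  rewrite neg_poweR_EFin// -EFinM -powRD ?Dn0 ?implybT// addrK powRr1//.
have mN V : measurable_wrt (F t) V -> (forall w, 0 <= V w) ->
    measurable_fun setT (fun w => neg_poweR (V w) s).
  move=> mV V0; apply: (measurable_sub_sigmaW (G := F t)).
  exact: measurable_neg_poweR.
apply: ae_eq_integral => //; [exact: mN|exact: mN|].
by apply: filterS WD => w ->.
Qed.

(** Domination of [P0] by [P1] makes [r] positive [P0]-a.s., hence every finite product [L n]
    positive [PP0]-a.s. This gives equivalence of the two powers on each [F n], which is enough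
    because the n-th condition is an event of [F n]. *)
Lemma iid_ae_equivalence t : P0 `<< P1 ->
  (forall n, (0 < n <= t)%N -> {ae PP1, forall w,
     E n w = tilted_ratio P0 r beta (coordinate n w)}) <->
  (forall n, (0 < n <= t)%N -> {ae PP0, forall w,
     E n w = tilted_ratio P0 r beta (coordinate n w)}).
Proof.
move=> /null_content_dominatesP dom01.
have r_gt0 : {ae P0, forall x, (0 < r x)%R}.
  pose B := [set x | (r x <= 0)%R].
  have mB : measurable B.
    rewrite (_ : B = setT `&` [set x | (r x)%:E <= 0]).
      exact: emeasurable_fun_infty_c.
    by rewrite setTI.
  exists B; split => //; last by move=> x /= /negP; rewrite -leNgt.
  have P1B : P1 B = 0.
    rewrite P1E//; apply: integral0_eq => x rx.
    by congr EFin; apply/eqP; rewrite eq_le rx r_ge0.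
  exact: dom01 mB P1B.
have rw_gt0 n : {ae PP0, forall w, (0 < r (coordinate n w))%R}.
  have [B [mB B0 rB]] := r_gt0; exists [set w | B (w n.-1)]; split.
  - by rewrite -[X in measurable X]setTI; exact: measurable_coordinateT.
  - by rewrite (countable_power_coordinate power0).
  - by move=> w /= rw; apply: rB.
have L_gt0 n : {ae PP0, forall w, (0 < L n w)%R}.
  elim: n => [|n IH]; first by apply: aeW => w; rewrite L0 ltr01.
  by apply: filterS2 IH (rw_gt0 n.+1) => w; rewrite LS; exact: mulr_gt0.
have Fn n : (0 < n <= t)%N -> sub_sigma_sets (F n)
    [set w | ~ E n w = tilted_ratio P0 r beta (coordinate n w)].
  move=> /andP[n0 _]; apply: sub_sigma_neq; first by have [] := betE n0.
  exact: measurable_tilted_coordinate.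
split=> Erho n nt.
  exact: (ae_density_conv (@mL n) (L_ge0 n) (@PP1E n) (L_gt0 n) (Fn n nt) (Erho n nt)).
exact: (ae_density (@mL n) (@PP1E n) (Fn n nt) (Erho n nt)).
Qed.

End iid_model.

Unset Implicit Arguments.
Set Strict Implicit.

Theorem proposition4p11 (R : realType) (s : R) (s_gt0 : (0 < s)%R) :
  let beta : R := ((1 + s)^-1)%R in
  (forall (d : measure_display) (T : measurableType d) (F : filtration T)
     (P0 P1 : probability T R),
     standing_assumption F P0 P1 ->
     forall (L : nat -> T -> R) (Z : nat -> T -> \bar R),
     is_likelihood_ratio F P0 P1 L ->
     is_Z F P0 L beta Z ->
     forall E : nat -> T -> \bar R,
     is_betting_sequence F P0 E ->
     (* (a) *)
     (forall t, (0 < t)%N ->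
        1 <= \int[P1]_w (neg_poweR (wealth E t w) s *
               expeR (\sum_(1 <= n < t.+1) lambda_of beta (Z n w))))
     /\
     (* (b) *)
     (forall lambda_bar : nat -> \bar R,
        (forall n, (0 < n)%N -> 0 <= lambda_bar n) ->
        (forall n, (0 < n)%N ->
           {ae P1, forall w, lambda_of beta (Z n w) <= lambda_bar n}) ->
        forall t, (0 < t)%N ->
          Lambda P1 E s t <=
          (t%:R^-1)%:E * \sum_(1 <= n < t.+1) lambda_bar n))
  /\
  (* (c) *)
  (forall (d : measure_display) (X : measurableType d)
     (P0 P1 : probability X R) (PP0 PP1 : probability (seqspace X) R),
     is_countable_power P0 PP0 ->
     is_countable_power P1 PP1 ->
     P1 `<< P0 ->
     KL P1 P0 < +oo ->
     forall r : X -> R, is_density P1 P0 r ->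
     forall E : nat -> seqspace X -> \bar R,
     is_betting_sequence (iid_filtration X) PP0 E ->
     forall t, (0 < t)%N ->
       [/\ Lambda PP1 E s t <= lambda_of beta (iid_Z P0 r beta),
           Lambda PP1 E s t = lambda_of beta (iid_Z P0 r beta) <->
           (forall n, (0 < n <= t)%N ->
              {ae PP1, forall w,
                 E n w = tilted_ratio P0 r beta (coordinate n w)})
         & P0 `<< P1 ->
           ((forall n, (0 < n <= t)%N ->
              {ae PP1, forall w,
                 E n w = tilted_ratio P0 r beta (coordinate n w)}) <->
            (forall n, (0 < n <= t)%N ->
              {ae PP0, forall w,
                 E n w = tilted_ratio P0 r beta (coordinate n w)}))]).
Proof.
split.
- move=> d T F P0 P1 SA L Z LR HZ E betE; split.
    by move=> t _; exact: (tilted_wealth_ge1 SA LR s_gt0 HZ betE).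
  by move=> lb lb0 lb_ge t t0; exact: (Lambda_le_mean SA LR s_gt0 HZ betE lb0 lb_ge).
- move=> d X P0 P1 PP0 PP1 pow0 pow1 dom _ r Hr E betE t t0; split.
  + exact: (iid_Lambda_le pow0 pow1 dom Hr s_gt0 betE t0).
  + exact: (iid_Lambda_eqP pow0 pow1 dom Hr s_gt0 betE t0).
  + exact: (iid_ae_equivalence pow0 pow1 dom Hr s_gt0 betE).
Qed.
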